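(* Let $(C,F,D,G)$ be the data of a hybrid inclusion on $\mathbb R^n$ satisfying the Hybrid Basic Conditions, and let $\mathcal S_{\mathcal H}$ be the set of its solutions. For every asymptotic solution $\phi$ of the hybrid inclusion, in particular for every bounded and complete solution $\phi\in\mathcal S_{\mathcal H}$, the set $\omega(\phi)$ is internally chain transitive (with respect to $\mathcal S_{\mathcal H}$).
   Context: $\mathbb B$ is the closed unit ball. A hybrid time domain is the union of a nondecreasing sequence of compact hybrid time domains, i.e. sets $\bigcup_{i=0}^{J-1}[t_i,t_{i+1}]\times\{i\}$ with $J\ge1$, $0=t_0\le\dots\le t_J$. A hybrid curve is a function $\phi:\mathrm{dom}\,\phi\to\mathbb R^n$ on a hybrid time domain such that $t\mapsto\phi(t,j)$ is continuous on $[t,t']$ whenever $(t,j),(t',j)\in\mathrm{dom}\,\phi$, $t<t'$; it is a hybrid arc if moreover these functions are absolutely continuous; it is complete if its domain is unbounded. The tail $\phi^{(s,i)}$, $(s,i)\in\mathrm{dom}\,\phi$, has domain $\{(t,j)\in[0,\infty)^2:(s+t,i+j)\in\mathrm{dom}\,\phi\}$ and values $\phi(s+t,i+j)$. Graphical convergence of mappings (viewed as set-valued mappings $\mathbb R^2\rightrightarrows\mathbb R^n$, empty-valued off their domains) means Painlevé–Kuratowski set convergence of their graphs in $\mathbb R^{n+2}$. Hybrid inclusion: $x\in C,\ \dot x\in F(x)$; $x\in D,\ x^+\in G(x)$, with $C,D\subset\mathbb R^n$, $F,G:\mathbb R^n\rightrightarrows\mathbb R^n$. Hybrid Basic Conditions: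 $C,D$ closed; $F,G$ outer semicontinuous and locally bounded; $F(x)$ nonempty and convex for all $x\in C$; $G(x)$ nonempty for all $x\in D$. A solution is a hybrid arc $\phi$ with $\phi(0,0)\in C\cup D$ such that: whenever $[t,t']\times\{j\}\subset\mathrm{dom}\,\phi$ with $t<t'$, $\phi(r,j)\in C$ and $\dot\phi(r,j)\in F(\phi(r,j))$ for almost all $r\in[t,t']$; whenever $(t,j),(t,j+1)\in\mathrm{dom}\,\phi$, $\phi(t,j)\in D$ and $\phi(t,j+1)\in G(\phi(t,j))$. $\mathcal S_{\mathcal H}$ is the set of all solutions. An asymptotic solution is a hybrid curve $\phi$ that is bounded, has unbounded domain, and such that for every graphically convergent sequence of tails $\phi^{(t_n,j_n)}$ with $(t_n,j_n)\in\mathrm{dom}\,\phi$, $t_n+j_n\to\infty$, the graphical limit is a complete element of $\mathcal S_{\mathcal H}$. $\omega(\phi)=\{z:\exists (t_n,j_n)\in\mathrm{dom}\,\phi,\ t_n+j_n\to\infty,\ \phi(t_n,j_n)\to z\}$. A set $K$ is internally chain transitive (with respect to a set $\mathcal L$ of hybrid curves) if for every $x,y\in K$ and $\tau,\varepsilon>0$ there exist $k^*\ge1$, points $x=x_0,\dots,x_{k^*}=y$, curves $\phi_0,\dots,\phi_{k^*-1}\in\mathcal L$ and $(t_k,j_k)\in\mathrm{dom}\,\phi_k$ with $t_k+j_k\ge\tau$ such that $\phi_k(0,0)=x_k$, $x_{k+1}\in\phi_k(t_k,j_k)+\varepsilon\mathbb B$, and $\phi_k(t,j)\in K$ for all $(t,j)\in\mathrm{dom}\,\phi_k$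 with $t+j\le t_k+j_k$. *)

(* Defs.v *)
From HB Require Import structures.
From mathcomp Require Import all_boot all_order all_algebra.
From mathcomp Require Import all_classical all_reals all_analysis.

Set Implicit Arguments.
Unset Strict Implicit.
Unset Printing Implicit Defensive.

Import Order.TTheory GRing.Theory Num.Theory.
Import numFieldNormedType.Exports.

Local Open Scope classical_set_scope.
Local Open Scope ring_scope.

(* R^n is 'rV[R]_n. Its library norm `|x| is the max norm; it is used wherever
   only the topology or boundedness matters. The unit ball is Euclidean. *)

Definition unit_ball (R : realType) (n : nat) : set 'rV[R]_n :=
  [set v | Num.sqrt (\sum_(i < n) v ord0 i ^+ 2) <= 1].

Definition outer_limit (T : topologicalType) (A : nat -> set T) : set T :=
  [set z | exists (s : nat -> nat) (u : nat -> T),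
     [/\ {homo s : k l / (k < l)%N}, forall k, A (s k) (u k)
       & u @ \oo --> z]].

Definition inner_limit (T : topologicalType) (A : nat -> set T) : set T :=
  [set z | exists u : nat -> T,
     (\forall k \near \oo, A k (u k)) /\ u @ \oo --> z].

(* Painleve-Kuratowski convergence *)
Definition set_converges (T : topologicalType) (A : nat -> set T) (L : set T) :=
  outer_limit A = L /\ inner_limit A = L.

Definition absolutely_continuous_on (R : realType) (V : normedModType R)
    (a b : R) (f : R -> V) : Prop :=
  forall e : R, 0 < e -> exists2 d : R, 0 < d &
    forall (m : nat) (l r : 'I_m -> R),
      (forall i, a <= l i /\ l i <= r i /\ r i <= b) ->
      trivIset setT (fun i => `]l i, r i[%classic) ->
      \sum_(i < m) (r i - l i) < d ->
      \sum_(i < m) `|f (r i) - f (l i)| < e.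

Definition compact_htd (R : realType) (E : set (R * nat)) : Prop :=
  exists (J : nat) (t : nat -> R),
    [/\ (1 <= J)%N, t 0%N = 0,
        forall i, (i < J)%N -> t i <= t i.+1
      & E = \bigcup_(i in `I_J) (`[t i, t i.+1]%classic `*` [set i])].

Definition htd (R : realType) (E : set (R * nat)) : Prop :=
  exists K : nat -> set (R * nat),
    [/\ forall k, compact_htd (K k), forall k, K k `<=` K k.+1
      & E = \bigcup_k K k].

(* A partial function on R x nat, as a domain and a total function whose
   values outside the domain are irrelevant. *)
Record pcurve (R : realType) (n : nat) := PCurve {
  dom : set (R * nat);
  val_at :> R -> nat -> 'rV[R]_n
}.

Definition hybrid_curve (R : realType) (n : nat) (phi : pcurve R n) : Prop :=
  htd (dom phi) /\
  forall (t t' : R) (j : nat), t < t' -> dom phi (t, j) -> dom phi (t', j) ->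
    {within `[t, t']%classic, continuous (fun r => phi r j)}.

Definition hybrid_arc (R : realType) (n : nat) (phi : pcurve R n) : Prop :=
  hybrid_curve phi /\
  forall (t t' : R) (j : nat), t < t' -> dom phi (t, j) -> dom phi (t', j) ->
    absolutely_continuous_on t t' (fun r => phi r j).

Definition complete_curve (R : realType) (n : nat) (phi : pcurve R n) : Prop :=
  ~ bounded_set [set ((p.1, p.2%:R) : R * R) | p in dom phi].

Definition bounded_curve (R : realType) (n : nat) (phi : pcurve R n) : Prop :=
  bounded_set [set phi p.1 p.2 | p in dom phi].

Definition tail (R : realType) (n : nat) (phi : pcurve R n) (s : R) (i : nat) :
    pcurve R n :=
  PCurve [set p | 0 <= p.1 /\ dom phi (s + p.1, (i + p.2)%N)]
         (fun t j => phi (s + t) (i + j)%N).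

Definition graph (R : realType) (n : nat) (phi : pcurve R n) :
    set (R * R * 'rV[R]_n) :=
  [set ((p.1, p.2%:R), phi p.1 p.2) | p in dom phi].

Record hybrid_inclusion (R : realType) (n : nat) := HybridInclusion {
  flow_set : set 'rV[R]_n;
  flow_map : 'rV[R]_n -> set 'rV[R]_n;
  jump_set : set 'rV[R]_n;
  jump_map : 'rV[R]_n -> set 'rV[R]_n
}.

Definition outer_semicontinuous (R : realType) (n : nat)
    (F : 'rV[R]_n -> set 'rV[R]_n) : Prop :=
  forall (x y : 'rV[R]_n) (xs ys : nat -> 'rV[R]_n),
    xs @ \oo --> x -> ys @ \oo --> y -> (forall k, F (xs k) (ys k)) -> F x y.

Definition locally_bounded (R : realType) (n : nat)
    (F : 'rV[R]_n -> set 'rV[R]_n) : Prop :=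
  forall x : 'rV[R]_n, exists2 U, nbhs x U & bounded_set (\bigcup_(y in U) F y).

Definition hybrid_basic_conditions (R : realType) (n : nat)
    (H : hybrid_inclusion R n) : Prop :=
  [/\ closed (flow_set H) /\ closed (jump_set H),
      outer_semicontinuous (flow_map H) /\ locally_bounded (flow_map H),
      outer_semicontinuous (jump_map H) /\ locally_bounded (jump_map H),
      forall x, flow_set H x -> flow_map H x !=set0 /\
        convex_set (flow_map H x : set (convex_lmodType 'rV[R]_n))
    & forall x, jump_set H x -> jump_map H x !=set0].

(* The derivative is two-sided: at the endpoints of [t, t'] it may involve values
   outside the domain, but these two points form a null set. *)
Definition solutions (R : realType) (n : nat) (H : hybrid_inclusion R n) :
    set (pcurve R n) :=
  [set phi |
    [/\ hybrid_arc phi,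
        (flow_set H `|` jump_set H) (phi 0 0%N),
        forall (t t' : R) (j : nat), t < t' ->
          `[t, t']%classic `*` [set j] `<=` dom phi ->
          {ae @lebesgue_measure R, forall r, r \in `[t, t'] ->
            [/\ flow_set H (phi r j),
                derivable (fun s => phi s j) r 1
              & flow_map H (phi r j) (derive1 (fun s => phi s j) r)]}
      & forall (t : R) (j : nat), dom phi (t, j) -> dom phi (t, j.+1) ->
          jump_set H (phi t j) /\ jump_map H (phi t j) (phi t j.+1)]].

Definition asymptotic_solution (R : realType) (n : nat)
    (H : hybrid_inclusion R n) (phi : pcurve R n) : Prop :=
  [/\ hybrid_curve phi, bounded_curve phi, complete_curve phi
    & forall (t : nat -> R) (j : nat -> nat) (L : set (R * R * 'rV[R]_n)),
        (forall k, dom phi (t k, j k)) ->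
        (fun k => t k + (j k)%:R) @ \oo --> +oo ->
        set_converges (fun k => graph (tail phi (t k) (j k))) L ->
        exists psi, [/\ solutions H psi, complete_curve psi & graph psi = L]].

Definition omega_limit (R : realType) (n : nat) (phi : pcurve R n) :
    set 'rV[R]_n :=
  [set z | exists (t : nat -> R) (j : nat -> nat),
     [/\ forall k, dom phi (t k, j k),
         (fun k => t k + (j k)%:R) @ \oo --> +oo
       & (fun k => phi (t k) (j k)) @ \oo --> z]].

Definition internally_chain_transitive (R : realType) (n : nat)
    (S : set (pcurve R n)) (K : set 'rV[R]_n) : Prop :=
  forall (x y : 'rV[R]_n) (tau e : R), K x -> K y -> 0 < tau -> 0 < e ->
  exists (m : nat) (xs : nat -> 'rV[R]_n) (phis : nat -> pcurve R n)
         (t : nat -> R) (j : nat -> nat),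
    [/\ (1 <= m)%N, xs 0%N = x, xs m = y
      & forall k, (k < m)%N ->
        [/\ S (phis k),
            dom (phis k) (t k, j k) /\ tau <= t k + (j k)%:R,
            phis k 0 0%N = xs k,
            exists2 b, unit_ball b & xs k.+1 = phis k (t k) (j k) + e *: b
          & forall (s : R) (i : nat), dom (phis k) (s, i) ->
              s + i%:R <= t k + (j k)%:R -> K (phis k s i)]].

(* Main.v *)
From HB Require Import structures.
Require Import Defs.
From mathcomp Require Import all_boot all_order all_algebra.
From mathcomp Require Import all_classical all_reals all_analysis.
From mathcomp Require Import measurable_realfun.
From mathcomp Require Import ring lra.

(** Let [phi] be an asymptotic solution and let [x], [y] be points of its omega-limit
    set. Far along [phi], any two points whose hybrid times differ by at least [tau]
    and at most a given bound are joined, up to a small error, by a solution that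
    stays in the omega-limit set ([shadowing]). Otherwise there would be ever later
    pairs of points that cannot be joined. Set convergence is sequentially compact
    ([set_converges_subseq]), so the tails of [phi] from the first points of these
    pairs converge graphically along a subsequence. Since [phi] is an asymptotic
    solution, the limit is a complete solution; it lies in the omega-limit set, and
    it joins the limits of the two points, a contradiction.

    The chain from [x] to [y] now follows [phi]. Its first solution is a limit of
    tails that start closer and closer to [x], so that it starts exactly at [x]
    ([omega_start]). A long stretch of [phi], from a late point near the end of that
    solution to a point near [y], is cut into pieces of hybrid length between [tau]
    and [2 * tau + 1], and each piece is shadowed ([chain_along]). Consecutive shadows
    match up to the error allowed in a chain.

    It remains to see that a bounded complete solution is an asymptotic solution
    ([solution_asymptotic]), that is, that graphical limits of its tails are
    solutions. Derivatives do not pass to such limits, so the inclusion is first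
    written without them: in each direction, the increments of the solution are
    bounded by means of the support function of the flow map ([integral_trajectory]).
    A solution has this property by the mean value inequality for absolutely
    continuous functions ([ac_growth]). The property is invariant under time shifts
    and passes to the limit by the closed graph and the local boundedness of the flow
    map ([limit_integral]); hybrid time domains are handled through a description
    that also passes to the limit ([chained]). Conversely, a curve with this property
    is Lipschitz between jumps, hence differentiable almost everywhere
    ([lipschitz_ae_derivable]), and a velocity outside the convex compact set of
    allowed velocities could be strictly separated from it, against the bound on
    the increments ([integral_derivative]). *)

Set Implicit Arguments.
Unset Strict Implicit.
Unset Printing Implicit Defensive.
Import Order.TTheory GRing.Theory Num.Theory.
Import numFieldNormedType.Exports.
Local Open Scope classical_set_scope.
Local Open Scope ring_scope.

(** * Almost everywhere derivatives on the line *)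
Lemma stieltjes_itv (R : realType) (g : cumulative R R) (a b : R) : a <= b ->
  lebesgue_stieltjes_measure g `]a, b]%classic = (g b - g a)%:E.
Proof.
move=> ab; rewrite /lebesgue_stieltjes_measure /measure_extension.
rewrite measurable_mu_extE/=; last exact: is_ocitv.
by rewrite wlength_itv_bnd.
Qed.

(** Both measures are infima over the same covers by half-open intervals, and on
    each interval the Stieltjes length is at most [K] times the Lebesgue length. *)
Lemma stieltjes_abs_cont (R : realType) (g : cumulative R R) (K : R) :
  0 < K -> (forall x y, x <= y -> g y - g x <= K * (y - x)) ->
  lebesgue_stieltjes_measure g `<< @lebesgue_measure R.
Proof.
move=> K0 gK; apply/null_content_dominatesP => A mA A0.
apply/eqP; rewrite eq_le measure_ge0 andbT.
apply/lee_addgt0Pr => e e0; rewrite add0e.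
have : (@lebesgue_measure R A < (e / K)%:E)%E by rewrite A0 lte_fin divr_gt0.
move=> /ereal_inf_lt[z [B [mB AB] <-] zlt].
have lewl n : (wlength g (B n) <= K%:E * wlength idfun (B n))%E.
  have /ocitvP[->|[[a b]/= ab ->]] : ocitv (B n) := mB n.
    by rewrite !wlength0 mule0.
  by rewrite !wlength_itv_bnd ?(ltW ab)// -EFinM lee_fin gK// ltW.
apply: (@le_trans _ _ (\sum_(k <oo) wlength g (B k))%E).
  by apply: ereal_inf_lbound; exists B.
apply: (@le_trans _ _ (\sum_(k <oo) (K%:E * wlength idfun (B k)))%E).
  by apply: lee_nneseries => // n _ _; exact: wlength_ge0.
rewrite nneseriesZl; last first.
  by move=> n _; exact: (wlength_ge0 idfun).
rewrite (_ : e = K * (e / K)) ?EFinM ?lee_pmul2l ?lte_fin//; first exact: ltW.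
by rewrite mulrC divfK// gt_eqF.
Qed.

(** The Stieltjes probability of [g] has a Radon-Nikodym density, so that [g] is,
    up to a constant, the indefinite integral of an integrable function; the
    Lebesgue differentiation theorem concludes. *)
Lemma cumulative_ae_derivable (R : realType) (g : cumulativeBounded (0 : R) 1)
    (K a : R) :
  0 < K -> (forall x y, x <= y -> g y - g x <= K * (y - x)) ->
  {ae @lebesgue_measure R, forall x, a < x -> derivable g x 1}.
Proof.
move=> K0 gK.
have [h [h0 hfin hint nuE]] := radon_nikodym_sigma_finite
  (stieltjes_abs_cont K0 gK).
pose h' := fine \o h.
have hE : h = EFin \o h' by apply/funext => x; rewrite /= fineK.
have int' (D : set R) : measurable D -> (@lebesgue_measure R).-integrable D (EFin \o h').
  by move=> mD; rewrite -hE; exact: (integrableS _ _ _ hint).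
have := @FTC1 R h' (BRight a).
move=> /(_ (fun y => int' _ (measurable_itv _)) _)/=.
have loc : locally_integrable [set: R] h'.
  by apply: open_integrable_locally; [exact: openT|exact: int'].
move=> /(_ loc).
apply: filterS; first exact: (ae_filter_ringOfSetsType lebesgue_measure).
move=> /= x H ax.
have [+ _] := H ax.
suff FE y : a < y -> (\int[lebesgue_measure]_(t in `]a, y]) h' t)%R = g y - g a.
  move=> dF.
  have : derivable (fun y => g y - g a) x 1.
    apply: near_eq_derivable dF.
    near=> y; apply: FE; near: y; exact: lt_nbhsr.
  move=> dF'.
  have E : {near x, (fun y => g y - g a) \+ cst (g a) =1 g}.
    by near=> y; rewrite /= subrK.
  apply: near_eq_derivable E _.
  exact: (derivableD dF' (derivable_cst (g a) x 1)).
move=> ay; have -> : (\int[lebesgue_measure]_(t in `]a, y]) h' t)%R =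
    fine (\int[lebesgue_measure]_(t in `]a, y]) h t)%E.
  by rewrite /Rintegral hE.
by rewrite -nuE//= stieltjes_itv// ltW.
Unshelve. all: by end_near. Qed.

(** Precomposing with the projection onto [a, b] makes a Lipschitz condition on
    that segment a global one. *)
Definition clamp (R : realType) (a b x : R) : R := Num.max a (Num.min x b).

Lemma clamp_itv (R : realType) (a b x : R) : a <= b -> a <= clamp a b x <= b.
Proof. by move=> ab; rewrite /clamp le_max lexx/= ge_max ab ge_min lexx orbT. Qed.

Lemma clamp_id (R : realType) (a b x : R) : a <= x -> x <= b -> clamp a b x = x.
Proof. by move=> ax xb; rewrite /clamp (min_idPl xb) (max_idPr ax). Qed.

Lemma clamp_le (R : realType) (a b x y : R) : x <= y -> clamp a b x <= clamp a b y.
Proof.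
move=> xy; rewrite /clamp.
by case: (leP x b) => ?; case: (leP y b) => ?; case: (leP a x) => ?;
  case: (leP a y) => ?; case: (leP a b) => ?; lra.
Qed.

Lemma clamp_lip (R : realType) (a b x y : R) : x <= y ->
  clamp a b y - clamp a b x <= y - x.
Proof.
move=> xy; rewrite /clamp.
by case: (leP x b) => ?; case: (leP y b) => ?; case: (leP a x) => ?;
  case: (leP a y) => ?; case: (leP a b) => ?; lra.
Qed.

(** Adding a steep linear function makes [f] increasing; clamped to [a, b] and
    rescaled, the sum is the distribution function of a probability, to which
    [cumulative_ae_derivable] applies. *)
Lemma lipschitz_ae_derivable (R : realType) (f : R -> R) (a b M : R) :
  (forall x y, a <= x -> x <= y -> y <= b -> `|f y - f x| <= M * (y - x)) ->
  {ae @lebesgue_measure R, forall x, a < x < b -> derivable f x 1}.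
Proof.
move=> fM.
have [ab|ba] := ltP a b; last first.
  by apply: aeW => /= x /andP[ax xb]; have := lt_le_trans (lt_trans ax xb) ba; rewrite ltxx.
(* With this slope, [h] below increases at least as fast as the identity. *)
pose N := `|M| + 1.
have N0 : 0 < N by rewrite ltr_wpDl.
have fN x y : a <= x -> x <= y -> y <= b -> `|f y - f x| <= `|M| * (y - x).
  move=> ax xy yb; apply: (le_trans (fM _ _ ax xy yb)).
  by rewrite ler_wpM2r ?subr_ge0// ler_norm.
pose h x := f x + N * x.
have hle x y : a <= x -> x <= y -> y <= b -> h x + (y - x) <= h y.
  move=> ax xy yb; have := fN _ _ ax xy yb; rewrite ler_norml /h /N => /andP[+ _].
  by lra.
have hge x y : a <= x -> x <= y -> y <= b -> h y - h x <= (`|M| + N) * (y - x).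
  move=> ax xy yb; have := fN _ _ ax xy yb; rewrite ler_norml /h => /andP[_].
  by lra.
pose d := h b - h a.
have d0 : 0 < d.
  have := hle a b (lexx _) (ltW ab) (lexx _); rewrite /d; move: ab; lra.
pose g x := (h (clamp a b x) - h a) / d.
have ccl x : a <= clamp a b x <= b by exact: clamp_itv (ltW ab).
have gnd : {homo g : x y / x <= y}.
  move=> x y xy; rewrite /g ler_pM2r ?invr_gt0// lerB//.
  have [/andP[ax xb] /andP[ay yb]] := (ccl x, ccl y).
  have := clamp_le a b xy => cxy.
  have := hle _ _ ax cxy yb; apply: le_trans; lra.
pose K := (`|M| + N) / d.
have K0 : 0 < K by rewrite divr_gt0// ltr_wpDl.
have gK x y : x <= y -> g y - g x <= K * (y - x).
  move=> xy; rewrite /g /K -mulrBl mulrAC ler_pM2r ?invr_gt0//.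
  have [/andP[ax xb] /andP[ay yb]] := (ccl x, ccl y).
  have cxy := clamp_le a b xy.
  have := hge _ _ ax cxy yb.
  have : (`|M| + N) * (clamp a b y - clamp a b x) <= (`|M| + N) * (y - x).
    by rewrite ler_wpM2l ?clamp_lip// addr_ge0// ltW.
  by lra.
have gabs x y : `|g x - g y| <= K * `|x - y|.
  have [xy|yx] := leP x y.
    by rewrite distrC [in leRHS]distrC !ger0_norm ?subr_ge0 ?gK// gnd.
  have yx' := ltW yx.
  by rewrite !ger0_norm ?subr_ge0 ?gK// gnd.
have gc : continuous g.
  move=> x; apply/cvgrPdist_le => e e0; near=> y.
  apply: (le_trans (gabs _ _)); rewrite -ler_pdivlMl//.
  near: y; have /cvgrPdist_le : id @ x --> x by exact: cvg_id.
  by apply; rewrite mulr_gt0// invr_gt0.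
have ga x : x <= a -> g x = 0.
  move=> xa; rewrite /g /clamp (min_idPl _) ?(le_trans xa)//; last exact: ltW.
  by rewrite (max_idPl xa) subrr mul0r.
have gb x : b <= x -> g x = 1.
  move=> bx; rewrite /g /clamp (min_idPr bx) (max_idPr (ltW ab)) divff//.
  by rewrite gt_eqF.
have g0 : g @ -oo --> (0 : R).
  apply: cvg_near_cst; near=> x; apply: ga; near: x; by apply: nbhs_ninfty_le; exact: num_real.
have g1 : g @ +oo --> (1 : R).
  apply: cvg_near_cst; near=> x; apply: gb; near: x; by apply: nbhs_pinfty_ge; exact: num_real.
pose G : cumulativeBounded (0 : R) 1 := HB.pack g
  (isCumulative.Build R _ R g gnd (right_continuousW gc))
  (isCumulativeBounded.Build R 0 1 g g0 g1).
have := @cumulative_ae_derivable R G K a K0 gK.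
apply: filterS; first exact: (ae_filter_ringOfSetsType lebesgue_measure).
move=> /= x /[swap] /andP[ax xb] /(_ ax) dG.
have dg : derivable (d \*: g) x 1 by apply: derivableZ.
have dgh := derivableD dg (derivable_cst (h a) x 1).
have dN : derivable (N \*: (id : R -> R)) x 1.
  by apply: derivableZ; exact: derivable_id.
have dgN := derivableB dgh dN.
apply: near_eq_derivable dgN.
near=> y; change (d * ((h (clamp a b y) - h a) / d) + h a - N * y = f y).
rewrite clamp_id.
- by rewrite mulrC divfK ?gt_eqF// /h; ring.
- by rewrite ltW//; near: y; exact: lt_nbhsr.
- by rewrite ltW//; near: y; exact: lt_nbhsl.
Unshelve. all: by end_near. Qed.

Lemma derivable_expansion (R : realType) (V : normedModType R) (f : R -> V) (s e : R) :
  derivable f s 1 -> 0 < e ->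
  exists2 d, 0 < d & forall y, `|y - s| < d ->
    `|f y - f s - (y - s) *: derive1 f s| <= e * `|y - s|.
Proof.
move=> df e0.
have : h^-1 *: ((f \o shift s) (h *: (1 : R)) - f s) @[h --> 0^'] --> derive1 f s.
  by rewrite derive1E; exact: df.
move=> /cvgrPdist_le/(_ e e0)[d /= d0 H].
exists d => // y yd.
have [->|ys] := eqVneq y s; first by rewrite !subrr scale0r subrr !normr0 mulr0.
have ys0 : y - s != 0 by rewrite subr_eq0.
have := H (y - s); rewrite /= sub0r normrN => /(_ yd ys0).
rewrite [_ *: 1]mulr1 subrK distrC => {}H.
have -> : f y - f s - (y - s) *: derive1 f s =
    (y - s) *: ((y - s)^-1 *: (f y - f s) - derive1 f s).
  by rewrite scalerBr scalerA divff// scale1r.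
by rewrite normrZ mulrC ler_wpM2r.
Qed.

(** Real induction in the form of Cousin's lemma: a property passes from [a] to
    [b] as soon as each point has a gauge across which it can be transported from
    left to right. Unlike a tagged partition, this form lets the property itself
    carry the sums of the argument. *)
Lemma cousin_induction (R : realType) (a b : R) (Q : R -> Prop) :
  a <= b -> Q a ->
  (forall s, a <= s -> s <= b -> exists2 d, 0 < d &
     forall x y, a <= x -> x <= s -> s <= y -> y <= b ->
       s - d < x -> y < s + d -> Q x -> Q y) ->
  Q b.
Proof.
move=> ab Qa step.
pose S := [set x | [/\ a <= x, x <= b & Q x]].
have Sa : S a by split.
have supS : has_sup S.
  by split; [exists a|exists b => x []].
have as_ : a <= sup S by apply: sup_upper_bound.
have sb : sup S <= b by apply: ge_sup; [exists a|move=> x []].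
have [d d0 H] := step _ as_ sb.
have [x [ax xb Qx] sx] := sup_adherent d0 supS.
have xs : x <= sup S by apply: sup_upper_bound.
have next y : sup S <= y -> y <= b -> y < sup S + d -> Q y.
  by move=> sy yb yd; exact: H Qx.
have [sltb|] := ltP (sup S) b; last first.
  move=> bs; apply: next => //; lra.
have [m [m1 m2 m3]] : exists m, [/\ sup S < m, m <= b & m < sup S + d].
  exists (Num.min b (sup S + d / 2)); rewrite lt_min ge_min gt_min lexx.
  by split => //; [apply/andP; split; lra|apply/orP; right; lra].
have : m <= sup S.
  by apply: sup_upper_bound => //; split => //; [lra|apply: next => //; lra].
lra.
Qed.

Lemma sum_lengths_lt (R : realType) (U : set R) (d : R) (m : nat) (l r : nat -> R) :
  open U -> (@lebesgue_measure R U < d%:E)%E ->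
  (forall i, (i < m)%N -> l i <= r i /\ `[l i, r i] `<=` U) ->
  (forall i j, (i < j < m)%N -> r i <= l j) ->
  trivIset setT (fun i : 'I_m => `]l i, r i[%classic) /\
  \sum_(i < m) (r i - l i) < d.
Proof.
move=> oU Ud lrU sep.
have dis (i j : 'I_m) z : (i < j)%N -> `]l i, r i[%classic z -> `]l j, r j[%classic z -> False.
  move=> ij /=; rewrite !in_itv/= => /andP[_ zr] /andP[lz _].
  have := sep i j; rewrite ij ltn_ord => /(_ isT); lra.
have tr : trivIset setT (fun i : 'I_m => `]l i, r i[%classic).
  move=> i j _ _ [z [zi zj]].
  apply/val_inj; case: (ltngtP i j) => // ij; exfalso.
  - exact: dis ij zi zj.
  - exact: dis ij zj zi.
split => //.
rewrite -lte_fin -sumEFin.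
apply: le_lt_trans Ud.
rewrite (eq_bigr (fun i : 'I_m => @lebesgue_measure R `]l i, r i[%classic)); last first.
  move=> i _; have [lr _] := lrU i (ltn_ord i).
  rewrite lebesgue_measure_itv/= lte_fin.
  by case: ltP => [//|rl]; rewrite (_ : r i = l i) ?subrr//; lra.
have mU : measurable (\big[setU/set0]_(i < m) `]l i, r i[%classic).
  by apply: bigsetU_measurable => i _; exact: measurable_itv.
rewrite -(measure_semi_additive_ord (@lebesgue_measure R) _ tr mU); last first.
  by move=> i; exact: measurable_itv.
apply: le_measure; rewrite ?inE//; first exact: open_measurable.
rewrite -(bigcup_mkord m (fun i => `]l i, r i[%classic)) => z [i/= im zi].
by have [_ H] := lrU i im; apply: H; exact: subset_itv_oo_cc zi.
Qed.

(** The mean value inequality for absolutely continuous functions. Around a point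
    of derivative at most [c] the increments are at most [c + e] times the length;
    the other points lie in a null set, hence in an open set [U] of measure so small
    that absolute continuity bounds the total variation of [f] over disjoint
    intervals of [U]. [cousin_induction] glues the two kinds of increments. *)
Lemma ac_growth (R : realType) (f : R -> R) (a b c : R) : a <= b ->
  absolutely_continuous_on a b f ->
  {ae @lebesgue_measure R, forall x, x \in `[a, b] ->
     derivable f x 1 /\ derive1 f x <= c} ->
  f b - f a <= c * (b - a).
Proof.
move=> ab acf [N [mN N0 subN]].
have key e : 0 < e -> f b - f a <= (c + e) * (b - a) + e + e.
  move=> e0; set C := c + e.
  have [d1 d10 acd] := acf e e0.
  pose d := Num.min d1 (e / (`|C| + 1)).
  have C1 : 0 < `|C| + 1 by rewrite ltr_wpDl.
  have d0 : 0 < d by rewrite lt_min d10 divr_gt0.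
  have Nfin : (@lebesgue_measure R N < +oo)%E by rewrite [ltLHS]N0 ltry.
  have [U [oU NU UNd]] := lebesgue_regularity_outer mN Nfin d0.
  have Ud : (@lebesgue_measure R U < d%:E)%E.
    apply: le_lt_trans UNd.
    rewrite -{1}(setDUK NU) (le_trans (measureU2 _ _ _))//.
      by apply: measurableD => //; exact: open_measurable.
    by rewrite [X in (X + _)%E]N0 add0e.
  (* The intervals [l i, r i] collect the pieces of [a, x] tagged by a point of
     the null set [N]. *)
  pose Q x := exists (m : nat) (l r : nat -> R),
    [/\ forall i, (i < m)%N -> [/\ a <= l i, l i <= r i, r i <= x & `[l i, r i] `<=` U],
      forall i j, (i < j < m)%N -> r i <= l j &
      f x - f a <= C * (x - a) + \sum_(i < m) (`|f (r i) - f (l i)| + `|C| * (r i - l i))].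
  suff [m [l [r [H1 H2 H3]]]] : Q b.
    have [tr sumd] := sum_lengths_lt oU Ud
      (fun i im => let: And4 _ lr _ lU := H1 i im in conj lr lU) H2.
    apply: (le_trans H3); rewrite -addrA lerD2l big_split/= lerD//.
      apply/ltW/(acd m (fun i => l i) (fun i => r i)) => //.
        by move=> i; have [] := H1 i (ltn_ord i).
      by apply: (lt_le_trans sumd); rewrite /d ge_min lexx.
    rewrite -mulr_sumr.
    apply: (@le_trans _ _ (`|C| * (e / (`|C| + 1)))).
      by rewrite ler_wpM2l// ltW// (lt_le_trans sumd)// /d ge_min lexx orbT.
    by rewrite mulrCA ler_piMr// ?ltW// ltr_pdivrMr// mul1r; lra.
  apply: (@cousin_induction _ a b Q ab).
    by exists 0%N, (fun=> 0), (fun=> 0); split => //; rewrite big_ord0 !subrr; lra.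
  move=> s as_ sb.
  have [Ns|Ns] := pselect (N s).
    have /nbhs_ballP[d2 /= d20 dU] : nbhs s U.
      by move: (NU _ Ns) => Us; exact: open_nbhs_nbhs.
    exists d2 => // x y ax xs sy yb dx yd [m [l [r [H1 H2 H3]]]].
    (* Append the interval [x, y] to the family. *)
    pose ext (u : nat -> R) z i := if (i < m)%N then u i else z.
    exists m.+1, (ext l x), (ext r y); split.
    - move=> i im; rewrite /ext; case: ifPn => [im'|_].
        by have [? ? ? ?] := H1 i im'; split => //; lra.
      split => //; try lra.
      move=> z /=; rewrite in_itv/= => /andP[xz zy]; apply: dU.
      by rewrite /ball/= ltr_norml; apply/andP; split; lra.
    - move=> i j /andP[ij jm]; rewrite /ext.
      have im : (i < m)%N by apply: leq_trans ij _.
      rewrite im; case: ifPn => [jm'|_]; first by apply: H2; rewrite ij.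
      by have [] := H1 i im.
    - have -> : \sum_(i < m.+1) (`|f (ext r y i) - f (ext l x i)| +
          `|C| * (ext r y i - ext l x i)) =
        \sum_(i < m) (`|f (r i) - f (l i)| + `|C| * (r i - l i)) +
          (`|f y - f x| + `|C| * (y - x)).
        rewrite big_ord_recr/= /ext ltnn; congr (_ + _).
        by apply: eq_bigr => i _; rewrite ltn_ord.
      have := ler_norm (f y - f x).
      have : 0 <= (`|C| + C) * (y - x).
        have /ler_normlP[? ?] := lexx `|C|.
        by rewrite mulr_ge0//; lra.
      by move: H3; lra.
  have [df dc] : derivable f s 1 /\ derive1 f s <= c.
    apply: contrapT => nd; apply: Ns; apply: subN => /= H; apply: nd; apply: H.
    by rewrite in_itv/= as_ sb.
  have [d2 d20 dfe] := derivable_expansion df e0.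
  have Hr y : s <= y -> y < s + d2 -> f y - f s <= C * (y - s).
    move=> sy yd; have := dfe y; rewrite ger0_norm ?subr_ge0// .
    have lt : y - s < d2 by lra.
    move=> /(_ lt).
    rewrite ler_norml /GRing.scale/= => /andP[_].
    have : (y - s) * derive1 f s <= (y - s) * c by rewrite ler_wpM2l// subr_ge0.
    rewrite /C; lra.
  have Hl x : x <= s -> s - d2 < x -> f s - f x <= C * (s - x).
    move=> xs yd; have := dfe x; rewrite ler0_norm ?subr_le0// .
    have lt : - (x - s) < d2 by lra.
    move=> /(_ lt).
    rewrite ler_norml /GRing.scale/= => /andP[+ _].
    have : (s - x) * derive1 f s <= (s - x) * c by rewrite ler_wpM2l// subr_ge0.
    rewrite /C; lra.
  exists d2 => // x y ax xs sy yb dx yd [m [l [r [H1 H2 H3]]]].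
  exists m, l, r; split => //.
    by move=> i im; have [? ? ? ?] := H1 i im; split => //; lra.
  by have := Hr y sy yd; have := Hl x xs dx; move: H3; lra.
apply/ler_addgt0Pr => e e0.
have p : 0 < b - a + 2 by lra.
have /key : 0 < e / (b - a + 2) by rewrite divr_gt0.
set z := _ / _; have : z * (b - a + 2) = e by rewrite divfK// gt_eqF.
lra.
Qed.

(** * Sequences and subsequences *)
Lemma subseq_ge (s : nat -> nat) : {homo s : k l / (k < l)%N} -> forall k, (k <= s k)%N.
Proof.
move=> hs; elim=> // k IH; apply: leq_trans (hs k k.+1 (leqnn _)); exact: IH.
Qed.

Lemma subseq_cvg (s : nat -> nat) : {homo s : k l / (k < l)%N} -> s @ \oo --> \oo.
Proof.
move=> hs A [N _ NA]; exists N => // k /= Nk; apply: NA => /=.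
exact: leq_trans Nk (subseq_ge hs k).
Qed.

Lemma cvg_subseq (T : topologicalType) (u : nat -> T) (s : nat -> nat) (z : T) :
  {homo s : k l / (k < l)%N} -> u @ \oo --> z -> (u \o s) @ \oo --> z.
Proof. by move=> /subseq_cvg sc uz; exact: cvg_comp uz. Qed.

Lemma choose_subseq (P : nat -> nat -> Prop) :
  (forall m N, exists2 k, (N <= k)%N & P m k) ->
  exists2 s : nat -> nat, {homo s : k l / (k < l)%N} & forall m, P m (s m).
Proof.
move=> H.
have /choice[g Hg] : forall mN : nat * nat, exists k, (mN.2 <= k)%N /\ P mN.1 k.
  by move=> [m N]; have [k] := H m N; exists k.
pose s := fix s m := if m is m'.+1 then g (m, (s m').+1) else g (0%N, 0%N).
have sS m : (s m < s m.+1)%N by have [] := Hg (m.+1, (s m).+1).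
exists s; first by apply: homo_ltn => //; exact: ltn_trans.
by case=> [|m]; [have [] := Hg (0%N, 0%N)|have [] := Hg (m.+1, (s m).+1)].
Qed.

Lemma cluster_subseq (R : realType) (T : pseudoMetricType R) (u : nat -> T) (z : T) :
  (forall e, 0 < e -> forall N, exists2 k, (N <= k)%N & ball z e (u k)) ->
  exists2 s : nat -> nat, {homo s : k l / (k < l)%N} & (u \o s) @ \oo --> z.
Proof.
move=> H.
have [|s hs sP] := @choose_subseq (fun m k => ball z (m.+1%:R^-1) (u k)).
  by move=> m N; apply: H; rewrite invr_gt0.
exists s => //; apply/cvg_ballP => e e0; near=> m.
apply: le_ball (sP m); apply/ltW.
by near: m; exact: near_infty_natSinv_lt (PosNum e0).
Unshelve. all: by end_near. Qed.

Lemma compact_subseq (R : realType) (T : pseudoMetricType R) (K : set T) (u : nat -> T) :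
  compact K -> (forall k, K (u k)) ->
  exists (s : nat -> nat) (z : T),
    [/\ {homo s : k l / (k < l)%N}, K z & (u \o s) @ \oo --> z].
Proof.
move=> cK Ku.
have [z [Kz cz]] : K `&` cluster (u @ \oo) !=set0.
  by apply: cK; exists 0%N => // k _; exact: Ku.
have [|s hs sz] := @cluster_subseq R T u z; last by exists s, z.
move=> e e0 N.
have [|_ [[k Nk <-] zk]] := cz (u @` [set k | (N <= k)%N]) (ball z e) _ (nbhsx_ballx z e e0).
  by exists N => // k Nk; exists k.
by exists k.
Qed.

Lemma bounded_subseq_R (R : realType) (u : nat -> R) (B : R) :
  (forall k, `|u k| <= B) ->
  exists (s : nat -> nat) (z : R), {homo s : k l / (k < l)%N} /\ (u \o s) @ \oo --> z.
Proof.
move=> uB; have [|s [z [hs _ sz]]] := @compact_subseq R R `[- B, B] u (@segment_compact _ _ _).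
  by move=> k; rewrite /= in_itv/= -ler_norml.
by exists s, z.
Qed.

Lemma bounded_subseq_rV (R : realType) (n : nat) (u : nat -> 'rV[R]_n) (B : R) :
  (forall k, `|u k| <= B) ->
  exists (s : nat -> nat) (z : 'rV[R]_n),
    {homo s : k l / (k < l)%N} /\ (u \o s) @ \oo --> z.
Proof.
move=> uB.
have cK : compact [set v : 'rV[R]_n | `|v| <= B].
  apply: bounded_closed_compact.
    exists B; split; first exact: num_real.
    by move=> x Bx v /= /le_trans; apply; exact: ltW.
  by apply: (@preimage_closed _ _ (fun v : 'rV[R]_n => `|v|) [set x | x <= B]);
    [move=> v _; exact: norm_continuous|exact: closed_le].
have [s [z [hs _ sz]]] := compact_subseq cK uB.
by exists s, z.
Qed.

(** The second coordinates of graphs are natural numbers seen in [R]; this brings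
    their limits back to eventually constant sequences. *)
Lemma cvg_natr (R : realType) (b : nat -> nat) (r : R) :
  (fun k => (b k)%:R : R) @ \oo --> r ->
  exists2 j, r = j%:R & \forall k \near \oo, b k = j.
Proof.
move=> br.
have /cvgrPdist_lt/(_ (1/2))[|N _ NH] := br; first by rewrite divr_gt0.
have E k : (N <= k)%N -> b k = b N.
  move=> Nk; have := NH k Nk; have := NH N (leqnn N); rewrite /= !ltr_norml.
  move=> /andP[? ?] /andP[? ?].
  have h1 : ((b k)%:R : R) < (b N).+1%:R by rewrite -natr1; lra.
  have h2 : ((b N)%:R : R) < (b k).+1%:R by rewrite -natr1; lra.
  by move: h1 h2; rewrite !ltr_nat !ltnS => h1 h2; apply/eqP; rewrite eqn_leq h1.
have nE : \forall k \near \oo, b k = b N by exists N => // k; exact: E.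
exists (b N) => //.
apply: (cvg_unique _ br) => //; apply: cvg_near_cst.
by move: nE; apply: filterS => k ->.
Qed.

Lemma bounded_setP (R : realType) (V : normedModType R) (A : set V) :
  bounded_set A -> exists2 B, 0 <= B & forall x, A x -> `|x| <= B.
Proof.
move=> [M [_ H]]; exists (`|M| + 1); first by rewrite addr_ge0.
by move=> x Ax; apply: (H (`|M| + 1)) => //; have := ler_norm M; lra.
Qed.

Lemma seq_closed (R : realType) (T : pseudoMetricType R) (A : set T) :
  (forall (u : nat -> T) z, (forall k, A (u k)) -> u @ \oo --> z -> A z) -> closed A.
Proof.
move=> H z clz.
have /choice[u Hu] : forall k : nat, exists x, A x /\ ball z (k.+1%:R^-1) x.
  move=> k; have k0 : 0 < k.+1%:R^-1 :> R by rewrite invr_gt0.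
  by have [x [Ax bx]] := clz _ (nbhsx_ballx z _ k0); exists x.
apply: (H u); first by move=> k; have [] := Hu k.
apply/cvg_ballP => e e0; near=> m.
have [_] := Hu m; apply: le_ball; apply/ltW.
by near: m; exact: near_infty_natSinv_lt (PosNum e0).
Unshelve. all: by end_near. Qed.

Lemma closed_seq (R : realType) (T : pseudoMetricType R) (A : set T) (u : nat -> T) z :
  closed A -> (\forall k \near \oo, A (u k)) -> u @ \oo --> z -> A z.
Proof. by move=> cA nA uz; exact: (closed_cvg _ cA nA _ uz). Qed.

(** Transfers a limit from one sequence of sampling times to another: this is how
    the uniform Lipschitz constant of the trajectories is used. *)
Lemma cvg_lip (R : realType) (V : normedModType R) (u v : nat -> V) (a b : nat -> R) (M : R)
    (z : V) (t : R) :
  u @ \oo --> z -> a @ \oo --> t -> b @ \oo --> t ->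
  (\forall k \near \oo, `|v k - u k| <= M * `|b k - a k|) -> v @ \oo --> z.
Proof.
move=> uz at_ bt near_.
have ba : (fun k => M * `|b k - a k|) @ \oo --> (0 : R).
  have -> : (0 : R) = M * `|t - t| by rewrite subrr normr0 mulr0.
  by apply: cvgM; [exact: cvg_cst|apply: cvg_norm; exact: cvgB].
apply/cvgrPdist_le => e e0.
have e20 : 0 < e / 2 by rewrite divr_gt0.
near=> k.
have h1 : `|z - u k| <= e / 2 by near: k; move/cvgrPdist_le : uz; apply.
have h2 : `|v k - u k| <= M * `|b k - a k| by near: k.
have h3 : `|0 - M * `|b k - a k| | <= e / 2 by near: k; move/cvgrPdist_le : ba; apply.
have h4 := ler_norm (M * `|b k - a k|).
rewrite sub0r normrN in h3.
rewrite (_ : z - v k = (z - u k) - (v k - u k)); last by rewrite opprB addrA subrK.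
rewrite (le_trans (ler_normB _ _))//.
lra.
Unshelve. all: by end_near. Qed.

Lemma cvg_fst_seq (T U : topologicalType) (u : nat -> T * U) (z : T * U) :
  u @ \oo --> z -> (fun k => (u k).1) @ \oo --> z.1.
Proof. by move=> uz; apply: (cvg_comp u fst uz); exact: cvg_fst. Qed.

Lemma cvg_snd_seq (T U : topologicalType) (u : nat -> T * U) (z : T * U) :
  u @ \oo --> z -> (fun k => (u k).2) @ \oo --> z.2.
Proof. by move=> uz; apply: (cvg_comp u snd uz); exact: cvg_snd. Qed.

Lemma cvg_pair_seq (T U : topologicalType) (u : nat -> T) (v : nat -> U) (x : T) (y : U) :
  u @ \oo --> x -> v @ \oo --> y -> (fun k => (u k, v k)) @ \oo --> (x, y).
Proof. by move=> ux vy; exact: (cvg_pair ux vy). Qed.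

(** * Sequential compactness of Painleve-Kuratowski convergence *)
(** The diagonal argument: countably many yes-or-no questions about the terms of a
    sequence are all eventually settled along one subsequence. The limit answers are
    built prefix by prefix, keeping the prefixes met infinitely often. *)
Lemma diagonal_bool (g : nat -> nat -> bool) :
  exists (s : nat -> nat) (b : nat -> bool),
    {homo s : k l / (k < l)%N} /\ forall m i, (i < m)%N -> g (s m) i = b i.
Proof.
pose good (p : seq bool) := forall N, exists2 k, (N <= k)%N &
  forall i, (i < size p)%N -> g k i = nth false p i.
pose step p := rcons p `[< good (rcons p true) >].
have good_step p : good p -> good (step p).
  move=> gp; rewrite /step; case: asboolP => // nt.
  (* The prefix extended by [true] is met finitely often, so that beyond some rank
     the next answer is [false]. *)
  have [N0 HN0] : exists N0, forall k, (N0 <= k)%N ->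
      ~ forall i, (i < size (rcons p true))%N -> g k i = nth false (rcons p true) i.
    apply: contrapT => H; apply: nt => N; apply: contrapT => H'.
    by apply: H; exists N => k Nk Hk; apply: H'; exists k.
  move=> N; have [k Nk Hk] := gp (maxn N N0).
  exists k; first exact: leq_trans (leq_maxl _ _) Nk.
  have {}HN0 := HN0 k (leq_trans (leq_maxr _ _) Nk).
  move=> i; rewrite size_rcons ltnS nth_rcons leq_eqVlt => /orP[/eqP ->|ip].
    rewrite ltnn eqxx; apply/negbTE/negP => gt; apply: HN0 => j.
    rewrite size_rcons ltnS nth_rcons leq_eqVlt => /orP[/eqP ->|jp].
      by rewrite ltnn eqxx.
    by rewrite jp; exact: Hk.
  by rewrite ip; exact: Hk.
pose pref m := iter m step [::].
have gpref m : good (pref m).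
  by elim: m => [|m IH]; [move=> N; exists N|exact: good_step].
have szp m : size (pref m) = m by elim: m => //= m IH; rewrite size_rcons IH.
pose b i := nth false (pref i.+1) i.
have prefE m i : (i < m)%N -> nth false (pref m) i = b i.
  elim: m => // m IH; rewrite ltnS leq_eqVlt => /orP[/eqP ->//|im].
  by rewrite /= nth_rcons szp im; exact: IH.
have [|s hs sP] := @choose_subseq (fun m k => forall i, (i < m)%N -> g k i = b i).
  move=> m N; have [k Nk Hk] := gpref m N; exists k => // i im.
  by rewrite Hk ?szp// prefE.
by exists s, b.
Qed.

Section kuratowski.
Context {R : realType} {T : pseudoMetricType R}.
Implicit Types (A : nat -> set T) (z : T).

(** Among the balls of radius [1 / (m + 1)], [m <= k], the point chosen in [A k] lies
    in all those that meet [A k]. *)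
Lemma inner_limit_ball A z :
  (forall e, 0 < e -> \forall k \near \oo, A k `&` ball z e !=set0) ->
  inner_limit A z.
Proof.
move=> H.
have Hu k : exists x, A k !=set0 -> A k x /\
    forall m, (m <= k)%N -> A k `&` ball z (m.+1%:R^-1) !=set0 -> ball z (m.+1%:R^-1) x.
  have [[y Ay]|nA] := pselect (A k !=set0); last by exists z.
  suff /(_ k)[x [Ax Hx]] : forall j, exists x, A k x /\
    forall m, (m <= j)%N -> A k `&` ball z (m.+1%:R^-1) !=set0 -> ball z (m.+1%:R^-1) x.
    by exists x.
  elim=> [|j [x [Ax Hx]]].
    have [[x [Ax bx]]|n0] := pselect (A k `&` ball z (1%:R^-1) !=set0).
      by exists x; split => // -[|//].
    by exists y; split => // -[_ /n0|].
  have [[w [Aw bw]]|nS] := pselect (A k `&` ball z (j.+2%:R^-1) !=set0).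
    exists w; split => // m mj _; apply: le_ball bw.
    by rewrite lef_pV2 ?posrE// ler_nat.
  exists x; split => // m; rewrite leq_eqVlt => /orP[/eqP ->//|].
  by rewrite ltnS; exact: Hx.
have /choice[u uP] := Hu.
exists u; split.
  apply: filterS (H 1 ltr01) => k [x [Ax _]].
  by have [|//] := uP k; exists x.
apply/cvg_ballP => e e0.
near \oo => m.
have me : m.+1%:R^-1 <= e :> R.
  by apply/ltW; near: m; exact: near_infty_natSinv_lt (PosNum e0).
have m0 : 0 < m.+1%:R^-1 :> R by rewrite invr_gt0.
near=> k.
have nek : A k `&` ball z (m.+1%:R^-1) !=set0 by near: k; exact: H.
have [|_ uk] := uP k; first by case: nek => x [Ax _]; exists x.
apply: (le_ball me); apply: uk => //.
by near: k; exists m.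
Unshelve. all: by end_near. Qed.

Lemma inner_sub_outer A : inner_limit A `<=` outer_limit A.
Proof.
move=> z [u [[N _ AN] uz]]; exists (fun k => (k + N)%N), (fun k => u (k + N)%N); split.
- by move=> k l; rewrite ltn_add2r.
- by move=> k; apply: AN; rewrite /= leq_addl.
- apply: (@cvg_subseq _ u (fun k => (k + N)%N)) uz.
  by move=> k l; rewrite ltn_add2r.
Qed.

(** Along a suitable subsequence, each ball of a countable base either meets all
    the sets from some rank on or misses all of them from some rank on; then a point
    approached along a further subsequence is approached along the whole
    sequence. *)
Lemma set_converges_subseq (d : nat -> T) A :
  (forall z e, 0 < e -> exists i, ball z e (d i)) ->
  exists (s : nat -> nat) (L : set T),
    {homo s : k l / (k < l)%N} /\ set_converges (A \o s) L.
Proof.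
move=> dd.
pose B (p : nat * nat) := ball (d p.1) (p.2.+1%:R^-1).
pose g k i := `[< exists2 p, pickle p = i & A k `&` B p !=set0 >].
have [s [b [hs sb]]] := diagonal_bool g.
exists s, (inner_limit (A \o s)); split => //; split => //.
apply/seteqP; split; last exact: inner_sub_outer.
move=> z [s' [u [hs' Au uz]]]; apply: inner_limit_ball => e e0.
have e20 : 0 < e / 2 by rewrite divr_gt0.
near \oo => m.
have me : m.+1%:R^-1 < e / 2 :> R.
  by near: m; exact: near_infty_natSinv_lt (PosNum e20).
have m0 : 0 < m.+1%:R^-1 / 2 :> R by rewrite divr_gt0// invr_gt0.
have [a za] := dd z _ m0.
pose p := (a, m).
have Bp x : ball z (m.+1%:R^-1 / 2) x -> B p x.
  by move=> zx; rewrite /B/=; apply: ball_splitr za zx.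
have bt : b (pickle p) = true.
  near \oo => k.
  rewrite -(sb (s' k)).
    apply/asboolP; exists p => //; exists (u k); split; first exact: Au.
    by apply: Bp; near: k; move/cvg_ballP : uz => /(_ _ m0).
  apply: leq_trans (subseq_ge hs' k).
  by near: k; exists (pickle p).+1.
near=> k.
have : g (s k) (pickle p) by rewrite sb ?bt//; near: k; exists (pickle p).+1.
move=> /asboolP[q /(pcan_inj pickleK) -> [x [Ax bx]]].
exists x; split => //.
have e2 : e = e / 2 + e / 2 by rewrite -splitr.
rewrite e2; apply: (@ball_triangle _ _ (d a)).
  apply: le_ball za; apply: (@le_trans _ _ (m.+1%:R^-1)); last exact: ltW.
  by rewrite ler_pdivrMr// ler_pMr ?invr_gt0// ler1n.
by apply: le_ball bx; exact: ltW.
Unshelve. all: by end_near. Qed.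
End kuratowski.

Lemma rat_dense (R : realType) (n : nat) :
  exists d : nat -> R * R * 'rV[R]_n, forall z e, 0 < e -> exists i, ball z e (d i).
Proof.
pose conv (q : rat * rat * 'rV[rat]_n) : R * R * 'rV[R]_n :=
  (ratr q.1.1, ratr q.1.2, map_mx ratr q.2).
exists (fun i => if unpickle i is Some q then conv q else 0).
move=> z e e0.
have ap (x : R) : exists q : rat, ball x e (ratr q).
  have [q] := @rat_in_itvoo _ (x - e) (x + e) ltac:(lra).
  rewrite in_itv/= => /andP[q1 q2]; exists q.
  by rewrite /ball/= ltr_norml; apply/andP; split; lra.
have [q1 h1] := ap z.1.1; have [q2 h2] := ap z.1.2.
have /choice[q3 h3] : forall i, exists q : rat, ball (z.2 ord0 i) e (ratr q).
  by move=> i; exact: ap.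
exists (pickle (q1, q2, \row_i q3 i)); rewrite pickleK /conv/=.
split; first by split; [exact: h1|exact: h2].
by split => // i j; rewrite !mxE ord1; exact: h3.
Qed.

(** * Hybrid time domains *)
(** An intrinsic form of being a hybrid time domain, stable under tails and limits:
    the slices are intervals that follow each other, with a common time at each
    jump. *)
Record chained (R : realType) (E : set (R * nat)) : Prop := Chained {
  chained00 : E (0, 0%N);
  chained_ge0 : forall t j, E (t, j) -> 0 <= t;
  chained_itv : forall s t r j, E (s, j) -> E (t, j) -> s <= r -> r <= t -> E (r, j);
  chained_junction : forall t j, E (t, j.+1) ->
    exists s, [/\ s <= t, E (s, j) & E (s, j.+1)];
  chained_step : forall s t j, E (s, j) -> E (t, j.+1) -> s <= t
}.

Definition unbounded_dom (R : realType) (E : set (R * nat)) : Prop :=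
  forall l, exists t j, E (t, j) /\ l <= t + j%:R.

Section chained_theory.
Context {R : realType}.
Implicit Types (E : set (R * nat)) (s t l : R) (i j : nat).

Lemma chained_mono E s t i j : chained E -> E (s, i) -> E (t, j) ->
  (i < j)%N -> s <= t.
Proof.
move=> cE Es; elim: j t => // j IH t Et.
rewrite ltnS leq_eqVlt => /orP[/eqP ij|ij].
  by rewrite ij in Es; exact: chained_step Es Et.
have [r [rt Er _]] := chained_junction cE Et.
exact: le_trans (IH _ Er ij) rt.
Qed.

Lemma chained_order E s t i j : chained E -> E (s, i) -> E (t, j) ->
  s + i%:R <= t + j%:R -> s <= t /\ (i <= j)%N.
Proof.
move=> cE Es Et; case: (ltngtP i j) => [ij _|ji st|<- st].
- by split => //; exact: chained_mono Es Et ij.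
- have := chained_mono cE Et Es ji; have : (j%:R : R) < i%:R by rewrite ltr_nat.
  by move: st; lra.
- by split => //; lra.
Qed.

(** A jump increases the hybrid time [t + j] by one, so that up to that of a given
    point this quantity takes values in every interval of length one. *)
Lemma chained_intermediate E t j l : chained E -> E (t, j) ->
  0 <= l -> l <= t + j%:R ->
  exists r i, [/\ E (r, i), l <= r + i%:R & r + i%:R <= l + 1].
Proof.
move=> cE; elim: j t => [|j IH] t Et l0.
  rewrite addr0 => lt; exists l, 0%N; rewrite addr0; split => //; last lra.
  exact: (chained_itv cE (chained00 cE) Et).
have [s [st Es Es1]] := chained_junction cE Et => lt.
have [ls|sl] := leP l (s + j%:R); first exact: IH ls.
have [ls1|sl1] := leP l (s + j.+1%:R).
  by exists s, j.+1; split => //; move: sl; rewrite -natr1; lra.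
exists (l - j.+1%:R), j.+1; split; try lra.
by apply: (chained_itv cE Es1 Et); lra.
Qed.

Lemma compact_htd_chained E : compact_htd E -> chained E.
Proof.
move=> [J [t [J1 t0 tmono ->]]].
have mono i j : (i <= j)%N -> (j <= J)%N -> t i <= t j.
  move=> ij; elim: j ij => [|j IH]; first by rewrite leqn0 => /eqP ->.
  rewrite leq_eqVlt => /orP[/eqP ->//|]; rewrite ltnS => ij jJ.
  exact: le_trans (IH ij (ltnW jJ)) (tmono _ jJ).
have inE s j : (\bigcup_(i in `I_J) (`[t i, t i.+1]%classic `*` [set i])) (s, j) <->
    (j < J)%N /\ t j <= s <= t j.+1.
  split => [[i /= iJ [/= si ->]]|[jJ sj]]; first by rewrite in_itv/= in si.
  by exists j => //; split => //=; rewrite in_itv.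
split.
- by apply/inE; rewrite J1 t0 lexx; split => //; rewrite -t0; exact: tmono.
- move=> s j /inE[jJ /andP[js _]]; apply: le_trans js.
  by rewrite -t0; apply: mono => //; exact: ltnW.
- move=> s s' r j /inE[jJ /andP[js _]] /inE[_ /andP[_ sj]] sr rs; apply/inE.
  by split => //; rewrite (le_trans js)// (le_trans rs).
- move=> s j /inE[jJ /andP[js _]]; exists (t j.+1); split => //; apply/inE.
    by split; [exact: ltnW|rewrite lexx andbT; apply: tmono; exact: ltnW].
  by split => //; rewrite lexx; exact: tmono.
- by move=> s s' j /inE[_ /andP[_ h1]] /inE[_ /andP[h2 _]]; exact: le_trans h2.
Qed.

Lemma htd_chained E : htd E -> chained E.
Proof.
move=> [K [cK KS ->]].
have mono (k l : nat) : (k <= l)%N -> K k `<=` K l.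
  move=> kl; elim: l kl => [|l IH]; first by rewrite leqn0 => /eqP ->.
  by rewrite leq_eqVlt => /orP[/eqP ->//|]; rewrite ltnS => /IH h; exact: subset_trans (KS l).
have cc k := compact_htd_chained (cK k).
have two p q : (\bigcup_k K k) p -> (\bigcup_k K k) q -> exists k, K k p /\ K k q.
  move=> [k _ Kp] [l _ Kq]; exists (maxn k l); split.
    exact: mono (leq_maxl _ _) _ Kp.
  exact: mono (leq_maxr _ _) _ Kq.
split.
- by exists 0%N => //; exact: chained00.
- by move=> t j [k _ /(chained_ge0 (cc k))].
- move=> s t r j Es Et sr rt; have [k [Ks Kt]] := two _ _ Es Et.
  by exists k => //; exact: (chained_itv (cc k) Ks Kt).
- move=> t j [k _ /(chained_junction (cc k))[s [st Ks Ks1]]].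
  by exists s; split => //; exists k.
- move=> s t j Es Et; have [k [Ks Kt]] := two _ _ Es Et.
  exact: chained_step (cc k) _ _ _ Ks Kt.
Qed.

(** The points of [E] up to [(T, J)] form a compact domain, whose switching times
    are the common times of consecutive slices. *)
Lemma chained_compact_htd E (T : R) (J : nat) : chained E -> E (T, J) ->
  compact_htd [set p | E p /\ p.1 + p.2%:R <= T + J%:R].
Proof.
move=> cE ET.
have occ i : (i <= J)%N -> exists t, E (t, i) .
  suff H : forall k i, (i + k)%N = J -> exists t, E (t, i).
    by move=> iJ; apply: (H (J - i)%N); rewrite subnKC.
  elim=> [|k IH] {}i ik; first by exists T; rewrite -(addn0 i) ik.
  have [|t /(chained_junction cE)[s [_ Es _]]] := IH i.+1; last by exists s.
  by rewrite addSnnS.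
have /choice[tau Htau] : forall i, exists s, (i < J)%N -> E (s, i) /\ E (s, i.+1).
  move=> i; have [iJ|_] := ltnP i J; last by exists 0.
  have [t /(chained_junction cE)[s [_ Es Es1]]] := occ _ iJ.
  by exists s.
(* [tau i] is the time of the jump from slice [i] to slice [i + 1]. *)
pose t i := if i is i'.+1 then (if (i' < J)%N then tau i' else T) else 0.
have Et i : (i <= J)%N -> E (t i, i).
  by case: i => [_|i iJ]; [exact: chained00|rewrite /t iJ; case: (Htau _ iJ)].
have EtS i : (i <= J)%N -> E (t i.+1, i).
  rewrite /t leq_eqVlt => /orP[/eqP ->|iJ]; first by rewrite ltnn.
  by rewrite iJ; case: (Htau _ iJ).
have tmin s i : E (s, i) -> t i <= s.
  case: i => [|i] Es; first exact: chained_ge0 Es.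
  rewrite /t; case: ifPn => iJ; first by have [h _] := Htau _ iJ; exact: chained_step h Es.
  by apply: (chained_mono cE ET Es); rewrite ltnS leqNgt.
have tmax s i : E (s, i) -> s + i%:R <= T + J%:R -> (i <= J)%N /\ s <= t i.+1.
  move=> Es /(chained_order cE Es ET)[sT iJ]; split => //.
  rewrite /t; case: ifPn => // iJ'; have [_ h] := Htau _ iJ'.
  exact: chained_step Es h.
exists J.+1, t; split => //.
  by move=> i; rewrite ltnS => iJ; apply: tmin; exact: EtS.
apply/seteqP; split => [[s i] /= [Es sl]|[s k] [i /= iJ [/= st ->]]].
  have [iJ si] := tmax _ _ Es sl.
  by exists i => //; split => //=; rewrite in_itv/= si tmin.
move: st iJ; rewrite ltnS in_itv/= => /andP[ts st] iJ.
split; first exact: chained_itv (Et _ iJ) (EtS _ iJ) ts st.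
have : t i.+1 <= T.
  rewrite /t; case: ifPn => // iJ'; have [h _] := Htau _ iJ'.
  exact: chained_mono h ET iJ'.
have : (i%:R : R) <= J%:R by rewrite ler_nat.
rewrite /=; lra.
Qed.

(** The exhausting compact domains end at points whose hybrid time lies between [k]
    and [k + 1]; hence they increase with [k]. *)
Lemma chained_htd E : chained E -> unbounded_dom E -> htd E.
Proof.
move=> cE uE.
have /choice[q Hq] : forall k : nat, exists q : R * nat,
    [/\ E q, k%:R <= q.1 + q.2%:R & q.1 + q.2%:R <= k%:R + 1].
  move=> k; have [t [j [Et kt]]] := uE k%:R.
  by have [r [i [Er kr rk]]] := chained_intermediate cE Et (ler0n _ _) kt; exists (r, i).
exists (fun k => [set p | E p /\ p.1 + p.2%:R <= (q k).1 + (q k).2%:R]); split.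
- move=> k; have [Eq _ _] := Hq k; move: Eq; case: (q k) => T J /= ET.
  exact: chained_compact_htd.
- move=> k p /= [Ep pk]; split => //; apply: (le_trans pk).
  have [_ _ h1] := Hq k; have [_ h2 _] := Hq k.+1.
  by apply: (le_trans h1); move: h2; rewrite -natr1.
- apply/seteqP; split => [p Ep|p [k _ []]//].
  exists (Num.bound `|p.1 + p.2%:R|) => //; split => //.
  have [_ h _] := Hq (Num.bound `|p.1 + p.2%:R|).
  apply: le_trans h; apply: (le_trans (ler_norm _)).
  by rewrite ltW// archi_boundP.
Qed.

Lemma chained_shift E s i : chained E -> E (s, i) ->
  chained [set p : R * nat | 0 <= p.1 /\ E (s + p.1, (i + p.2)%N)].
Proof.
move=> cE Es; split => /=.
- by rewrite addr0 addn0.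
- by move=> t j [].
- move=> a b r j [a0 Ea] [b0 Eb] ar rb; split; first exact: le_trans ar.
  by apply: (chained_itv cE Ea Eb); rewrite lerD2l.
- move=> t j [t0]; rewrite addnS => /[dup] Et /(chained_junction cE)[r [rt Er Er1]].
  have sr : s <= r by apply: chained_mono Es Er1 _ => //; rewrite ltnS leq_addr.
  have E1 : s + (r - s) = r by lra.
  by exists (r - s); rewrite E1; split; [lra|split => //; lra|split => //; lra].
- move=> a b j [_ Ea] [_]; rewrite addnS => Eb.
  by have := chained_step cE Ea Eb; lra.
Qed.

Lemma unbounded_shift E s i : chained E -> unbounded_dom E -> E (s, i) ->
  unbounded_dom [set p : R * nat | 0 <= p.1 /\ E (s + p.1, (i + p.2)%N)].
Proof.
move=> cE uE Es l.
have [t [j [Et lt]]] := uE (`|l| + s + i%:R).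
have [st ij] : s <= t /\ (i <= j)%N.
  by apply: (chained_order cE Es Et); have := normr_ge0 l; lra.
exists (t - s), (j - i)%N; split; last first.
  by rewrite natrB//; have := ler_norm l; lra.
by rewrite /= subnKC// (_ : s + (t - s) = t); [split => //; lra|lra].
Qed.

End chained_theory.

Lemma complete_unbounded (R : realType) (n : nat) (phi : pcurve R n) :
  chained (dom phi) -> complete_curve phi <-> unbounded_dom (dom phi).
Proof.
move=> cE; split => [nb l|uE [M [_ /(_ (M + 1))]]].
  apply: contrapT => H; apply: nb; exists l; split; first exact: num_real.
  move=> x lx _ [[t j] Et <-]/=.
  have t0 := chained_ge0 cE Et.
  rewrite prod_normE/= ge_max !ger0_norm//.
  have : t + j%:R < l.
    by rewrite ltNge; apply/negP => h; apply: H; exists t, j.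
  have : (0 : R) <= j%:R by [].
  by move=> ? ?; apply/andP; split; lra.
move=> /(_ ltac:(lra)) H.
have [t [j [Et ]]] := uE (2 * (M + 1) + 1).
have tj : [set ((p.1, p.2%:R) : R * R) | p in dom phi] (t, j%:R) by exists (t, j).
have /= := H _ tj; rewrite prod_normE/= ge_max => /andP[h1 h2].
by have := ler_norm t; have := ler_norm (j%:R : R); lra.
Qed.

(** * Scalar product and separation of a point from a convex set *)
Section dot_product.
Context {R : realType} {n : nat}.
Implicit Types (u v w : 'rV[R]_n).

Definition dot u v : R := \sum_i u ord0 i * v ord0 i.
Definition norm1 u : R := \sum_i `|u ord0 i|.

Lemma norm1_ge0 u : 0 <= norm1 u. Proof. exact: sumr_ge0. Qed.

Lemma dotC u v : dot u v = dot v u.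
Proof. by apply: eq_bigr => i _; rewrite mulrC. Qed.

Lemma dotDr w u v : dot w (u + v) = dot w u + dot w v.
Proof. by rewrite /dot -big_split; apply: eq_bigr => i _; rewrite mxE mulrDr. Qed.

Lemma dotZr w (a : R) v : dot w (a *: v) = a * dot w v.
Proof. by rewrite /dot mulr_sumr; apply: eq_bigr => i _; rewrite mxE mulrCA. Qed.

Lemma dotNr w v : dot w (- v) = - dot w v.
Proof. by rewrite -scaleN1r dotZr mulN1r. Qed.

Lemma dotBr w u v : dot w (u - v) = dot w u - dot w v.
Proof. by rewrite dotDr dotNr. Qed.

Lemma dot0r w : dot w 0 = 0.
Proof. by rewrite -(scale0r 0) dotZr mul0r. Qed.

Lemma coord_le_norm v i : `|v ord0 i| <= `|v|.
Proof. by rewrite [leRHS]/Num.Def.normr/= mx_normrE (le_bigmax _ _ (ord0, i)). Qed.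

(** The norm is the maximum norm. *)
Lemma norm_le_coord v (B : R) : 0 <= B -> (forall i, `|v ord0 i| <= B) -> `|v| <= B.
Proof.
move=> B0 H; rewrite /Num.Def.normr/= mx_normrE (bigmax_le _ B0)//= => -[i j] _.
by rewrite ord1.
Qed.

Lemma dot_bound w v : `|dot w v| <= norm1 w * `|v|.
Proof.
rewrite (le_trans (ler_norm_sum _ _ _))// /norm1 mulr_suml ler_sum// => i _.
by rewrite normrM ler_wpM2l// coord_le_norm.
Qed.

Lemma cvg_dot (T : Type) (F : set_system T) (f g : T -> 'rV[R]_n) u v :
  Filter F -> f @ F --> u -> g @ F --> v ->
  (fun x => dot (f x) (g x)) @ F --> dot u v.
Proof.
move=> FF fu gv; apply: cvg_big => [|i _]; first exact: add_continuous.
have c (h : T -> 'rV[R]_n) (z : 'rV[R]_n) : h @ F --> z -> (fun x => h x ord0 i) @ F --> z ord0 i.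
  by move=> hz; apply: (cvg_comp h (fun M : 'rV[R]_n => M ord0 i) hz); exact: coord_continuous.
by apply: cvgM; exact: c.
Qed.

Lemma dot_cvg w (T : Type) (F : set_system T) (u : T -> 'rV[R]_n) v : Filter F ->
  u @ F --> v -> (fun k => dot w (u k)) @ F --> dot w v.
Proof. by move=> FF uv; apply: cvg_dot => //; exact: cvg_cst. Qed.

Lemma dotvv_ge0 v : 0 <= dot v v.
Proof. by apply: sumr_ge0 => i _; rewrite -expr2 sqr_ge0. Qed.

Lemma dotvv_eq0 v : dot v v = 0 -> v = 0.
Proof.
move=> h; apply/rowP => i; rewrite mxE; apply/eqP; rewrite -[_ == _]orbb -mulf_eq0.
move: h => /eqP; rewrite psumr_eq0; last by move=> j _; rewrite -expr2 sqr_ge0.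
by move=> /allP/(_ i (mem_index_enum _)).
Qed.


Lemma dot_sqrBZ w z (l : R) :
  dot (w - l *: z) (w - l *: z) = dot w w - 2 * l * dot w z + l ^+ 2 * dot z z.
Proof.
rewrite dotBr dotZr (dotC (w - _) w) (dotC (w - _) z) !dotBr !dotZr (dotC z w).
by ring.
Qed.

(** The separating direction is [v - p], where [p] is the point of [K] nearest to [v]
    for the Euclidean distance. *)
Lemma convex_separation (K : set 'rV[R]_n) v :
  compact K -> K !=set0 -> convex_set (K : set (convex_lmodType 'rV[R]_n)) ->
  ~ K v -> exists w c, (forall y, K y -> dot w y <= c) /\ c < dot w v.
Proof.
move=> cK K0 convK nKv.
have [|p pK pmin] := @EVT_min_rV R n (fun y => dot (v - y) (v - y)) K K0 cK.
  apply: continuous_subspaceT => y.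
  have c : (fun x : 'rV[R]_n => v - x) @ y --> v - y.
    by apply: continuousB; [exact: cst_continuous|exact: cvg_id].
  exact: (@cvg_dot _ _ (fun x => v - x) (fun x => v - x) _ _ (nbhs_filter y) c c).
rewrite inE in pK.
set w := v - p; exists w, (dot w p); split; last first.
  rewrite -subr_gt0 -dotBr -/w lt_neqAle dotvv_ge0 andbT eq_sym.
  by apply/eqP => /dotvv_eq0/eqP; rewrite subr_eq0 => /eqP vp; rewrite vp in nKv.
move=> y Ky.
set z := y - p.
(* Minimality of [p] against the points of the segment from [p] to [y]. *)
have min l : 0 < l -> l <= 1 -> 2 * dot w z <= l * dot z z.
  move=> l0 l1.
  have Kl : K (l *: y + (1 - l) *: p).
    by have := convK y p (Itv01 (ltW l0) l1); rewrite !inE; apply.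
  have := pmin (l *: y + (1 - l) *: p); rewrite inE => /(_ Kl).
  have -> : v - (l *: y + (1 - l) *: p) = w - l *: z.
    by apply/rowP => i; rewrite /w /z !mxE; ring.
  rewrite dot_sqrBZ -/w => h; rewrite -(ler_pM2l l0); move: h; lra.
suff : dot w z <= 0 by rewrite /z dotBr subr_le0.
rewrite leNgt; apply/negP => wz0.
have q0 : 0 < dot z z + 1 by rewrite ltr_wpDl// dotvv_ge0.
(* A value of [l] for which the quadratic term is at most half of the linear one. *)
pose l := Num.min 1 (dot w z / (dot z z + 1)).
have l0 : 0 < l by rewrite lt_min ltr01 divr_gt0.
have l1 : l <= 1 by rewrite ge_min lexx.
have l2 : l <= dot w z / (dot z z + 1) by rewrite ge_min lexx orbT.
have := min l l0 l1.
have : l * dot z z <= dot w z.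
  rewrite -[leRHS](divfK (negbT (gt_eqF q0))) ler_pM ?dotvv_ge0 ?(ltW l0)//.
  lra.
lra.
Qed.

End dot_product.

(** * Outer semicontinuous, locally bounded maps *)
Section set_valued_maps.
Context {R : realType} {n : nat} (F : 'rV[R]_n -> set 'rV[R]_n).

(** The closed-graph property in the form in which it is used: images of a
    convergent sequence accumulate in the image of the limit. *)
Lemma osc_subseq (xs ys : nat -> 'rV[R]_n) (x : 'rV[R]_n) :
  outer_semicontinuous F -> locally_bounded F ->
  xs @ \oo --> x -> (forall k, F (xs k) (ys k)) ->
  exists s y, [/\ {homo s : k l / (k < l)%N}, (ys \o s) @ \oo --> y & F x y].
Proof.
move=> oF lF xsx Fxy.
have [U Ux /bounded_setP[B B0 HB]] := lF x.
have [N _ HN] : \forall k \near \oo, U (xs k) by exact: xsx.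
have yB k : `|ys (k + N)%N| <= B.
  by apply: HB; exists (xs (k + N)%N) => //; apply: HN; rewrite /= leq_addl.
have [s [y [hs sy]]] := @bounded_subseq_rV R n (fun k => ys (k + N)%N) B yB.
have hs' : {homo (fun k => (s k + N)%N) : k l / (k < l)%N}.
  by move=> k l kl; rewrite ltn_add2r; exact: hs.
exists (fun k => (s k + N)%N), y; split => //.
apply: (oF x y (xs \o (fun k => (s k + N)%N)) (ys \o (fun k => (s k + N)%N))).
- exact: cvg_subseq.
- exact: sy.
- by move=> k; exact: Fxy.
Qed.

Lemma locally_bounded_bounded (B : R) : locally_bounded F ->
  exists2 M, 0 <= M & forall x y, `|x| <= B -> F x y -> `|y| <= M.
Proof.
move=> lF; apply: contrapT => H.
have /choice[f Hf] : forall k : nat, exists p : 'rV[R]_n * 'rV[R]_n,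
    [/\ `|p.1| <= B, F p.1 p.2 & k%:R < `|p.2|].
  move=> k; apply: contrapT => H'; apply: H; exists k%:R => // x y xB Fxy.
  by rewrite leNgt; apply/negP => ky; apply: H'; exists (x, y).
have fB k : `|(f k).1| <= B by have [] := Hf k.
have [s [x [hs sx]]] := @bounded_subseq_rV R n (fun k => (f k).1) B fB.
have [U Ux /bounded_setP[C C0 HC]] := lF x.
near \oo => k.
have [_ Fk Ck] := Hf (s k).
have : `|(f (s k)).2| <= C.
  by apply: HC; exists (f (s k)).1 => //; near: k; exact: sx.
have : C <= k%:R by near: k; exact: nbhs_infty_ger.
have : (k%:R : R) <= (s k)%:R by rewrite ler_nat subseq_ge.
by move: Ck; lra.
Unshelve. all: by end_near. Qed.

Lemma osc_compact x : outer_semicontinuous F -> locally_bounded F -> compact (F x).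
Proof.
move=> oF lF; apply: bounded_closed_compact.
  have [U Ux [M [Mr HM]]] := lF x; exists M; split => // y My v Fv.
  by apply: (HM y My); exists x => //; exact: nbhs_singleton.
apply: seq_closed => u z Fu uz.
by apply: (oF x z (fun=> x) u) => //; exact: cvg_cst.
Qed.

End set_valued_maps.

(** * The hybrid inclusion without derivatives *)
(** The differential inclusion is replaced by [it_mean]: in each direction [w], the
    increment over a time interval is bounded by the length times any upper bound of
    the support function of the flow map along the way. Only increments occur, so
    that the condition is invariant under time shifts and passes to pointwise limits;
    since its values on the flow set are convex and compact, nothing is lost
    ([integral_solution]). *)
Record integral_trajectory (R : realType) (n : nat) (H : hybrid_inclusion R n)
    (M : R) (phi : pcurve R n) : Prop := IntegralTrajectory {
  it_chained : chained (dom phi);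
  it_unbounded : unbounded_dom (dom phi);
  it_flow_set : forall t t' r j, t < t' -> dom phi (t, j) -> dom phi (t', j) ->
    t <= r -> r <= t' -> flow_set H (phi r j);
  it_mean : forall t t' j w c, t <= t' -> dom phi (t, j) -> dom phi (t', j) ->
    (forall r v, t <= r -> r <= t' -> flow_map H (phi r j) v -> dot w v <= c) ->
    dot w (phi t' j - phi t j) <= c * (t' - t);
  it_lipschitz : forall t t' j, dom phi (t, j) -> dom phi (t', j) ->
    `|phi t' j - phi t j| <= M * `|t' - t|;
  it_jump : forall t j, dom phi (t, j) -> dom phi (t, j.+1) ->
    jump_set H (phi t j) /\ jump_map H (phi t j) (phi t j.+1)
}.

Lemma integral_tail (R : realType) (n : nat) (H : hybrid_inclusion R n) M phi s i :
  integral_trajectory H M phi -> dom phi (s, i) ->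
  integral_trajectory H M (tail phi s i).
Proof.
move=> I Es; have cE := it_chained I.
split => /=.
- exact: chained_shift.
- exact: unbounded_shift (it_unbounded I) Es.
- move=> t t' r j tt' [_ Et] [_ Et'] tr rt.
  by apply: (it_flow_set I _ Et Et'); rewrite ?lerD2l ?ltrD2l.
- move=> t t' j w c tt' [_ Et] [_ Et'] Hc.
  have := @it_mean _ _ _ _ _ I (s + t) (s + t') (i + j)%N w c.
  rewrite lerD2l (_ : s + t' - (s + t) = t' - t); last by ring.
  apply => // r v sr rs Fv; apply: (Hc (r - s) v); try lra.
  by rewrite (_ : s + (r - s) = r)//; ring.
- move=> t t' j [_ Et] [_ Et'].
  have := it_lipschitz I Et Et'.
  by rewrite (_ : s + t' - (s + t) = t' - t)//; ring.
- by move=> t j [_ Et] [_]; rewrite addnS; exact: (it_jump I).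
Qed.

Lemma ac_dot (R : realType) (n : nat) (a b : R) (f : R -> 'rV[R]_n) w :
  absolutely_continuous_on a b f ->
  absolutely_continuous_on a b (fun r => dot w (f r)).
Proof.
move=> acf e e0.
have k0 : 0 < norm1 w + 1 by rewrite ltr_wpDl// norm1_ge0.
have [|d d0 H] := acf (e / (norm1 w + 1)); first by rewrite divr_gt0.
exists d => // m l r lr tr sd.
have := H m l r lr tr sd; rewrite ltr_pdivlMr// => h.
apply: le_lt_trans h; rewrite mulr_suml ler_sum// => i _.
rewrite -dotBr (le_trans (dot_bound _ _))// mulrC ler_wpM2l//.
by rewrite lerDl.
Qed.

Lemma derive1_dot (R : realType) (n : nat) (f : R -> 'rV[R]_n) w r :
  derivable f r 1 ->
  derivable (fun s => dot w (f s)) r 1 /\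
  derive1 (fun s => dot w (f s)) r = dot w (derive1 f r).
Proof.
move=> df.
have E : (fun h => h^-1 *: (((fun s => dot w (f s)) \o shift r) (h *: (1 : R)) - dot w (f r)))
  = (fun h : R => dot w (h^-1 *: ((f \o shift r) (h *: (1 : R)) - f r))).
  by apply/funext => h; rewrite /= dotZr dotBr.
have c : (fun h => h^-1 *: (((fun s => dot w (f s)) \o shift r) (h *: (1 : R)) - dot w (f r)))
   @ 0^' --> dot w (derive1 f r).
  by rewrite E derive1E; apply: dot_cvg; exact: df.
split; first by apply/cvg_ex; exists (dot w (derive1 f r)).
by rewrite derive1E; apply/cvg_lim.
Qed.

(** A nondegenerate interval has positive measure. *)
Lemma ae_dense (R : realType) (P : R -> Prop) (a b : R) : a < b ->
  {ae @lebesgue_measure R, forall r, P r} -> exists r, [/\ a < r, r < b & P r].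
Proof.
move=> ab [N [mN N0 sub]]; apply: contrapT => H.
have sN : `]a, b[%classic `<=` N.
  move=> r; rewrite /= in_itv/= => /andP[ar rb]; apply: sub => Pr.
  by apply: H; exists r.
have : (@lebesgue_measure R `]a, b[%classic <= 0)%E.
  by rewrite -[leRHS]N0 le_measure ?inE.
by rewrite lebesgue_measure_itv/= lte_fin ab -EFinB lee_fin; lra.
Qed.

Section solution_to_integral.
Context {R : realType} {n : nat}.

Lemma ac_continuous (a b : R) (f : R -> 'rV[R]_n) :
  absolutely_continuous_on a b f -> forall e, 0 < e -> exists2 d, 0 < d &
    forall r s, a <= r -> r <= s -> s <= b -> s - r < d -> `|f s - f r| < e.
Proof.
move=> acf e e0; have [d d0 H] := acf e e0; exists d => // r s ar rs sb sd.
have := H 1%N (fun=> r) (fun=> s); rewrite !big_ord1; apply => //.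
by move=> i j _ _ _; rewrite !ord1.
Qed.

(** On the bounded range of [phi] the flow map is bounded by some [M]; [ac_growth]
    applied to the scalar products of [phi] with fixed vectors yields [it_mean], and
    the coordinate vectors then give the Lipschitz constant [M]. Membership in the
    closed flow set extends from almost every time to every time by continuity. *)
Lemma solution_integral (H : hybrid_inclusion R n) (phi : pcurve R n) :
  hybrid_basic_conditions H -> solutions H phi -> bounded_curve phi ->
  complete_curve phi -> exists2 M, 0 <= M & integral_trajectory H M phi.
Proof.
move=> [[cC cD] [oF lF] _ FC _] [[[hE cphi] acphi] phi0 flow jump].
move=> /bounded_setP[B B0 HB] cpl.
have cE := htd_chained hE.
have vB t j : dom phi (t, j) -> `|phi t j| <= B.
  by move=> Et; apply: HB; exists (t, j).
have [M M0 HM] := locally_bounded_bounded B lF.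
have slice t t' j : dom phi (t, j) -> dom phi (t', j) ->
    `[t, t']%classic `*` [set j] `<=` dom phi.
  move=> Et Et' [r i] /= [+ ->]; rewrite in_itv/= => /andP[tr rt].
  exact: chained_itv Et Et' tr rt.
have mean t t' j w c : t <= t' -> dom phi (t, j) -> dom phi (t', j) ->
    (forall r v, t <= r -> r <= t' -> flow_map H (phi r j) v -> dot w v <= c) ->
    dot w (phi t' j - phi t j) <= c * (t' - t).
  rewrite le_eqVlt => /orP[/eqP <- _ _ _|tt' Et Et' Hc].
    by rewrite !subrr dot0r mulr0.
  rewrite dotBr.
  apply: (@ac_growth R (fun r => dot w (phi r j))); first exact: ltW.
    by apply: ac_dot; exact: acphi.
  have := flow _ _ _ tt' (slice _ _ _ Et Et').
  apply: filterS; first exact: (ae_filter_ringOfSetsType lebesgue_measure).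
  move=> r h rt; have [_ dr Fr] := h rt.
  have [dd ->] := derive1_dot w dr; split => //.
  by move: rt; rewrite in_itv/= => /andP[tr rt']; exact: Hc Fr.
exists M => //; split => //.
- by apply/complete_unbounded.
- move=> t t' r j tt' Et Et' tr rt; apply: contrapT => nC.
  have oC : open (~` flow_set H) by exact: closed_openC.
  have /nbhs_ballP[e /= e0 He] : nbhs (phi r j) (~` flow_set H).
    exact: open_nbhs_nbhs.
  have [d d0 Hd] := ac_continuous (acphi _ _ _ tt' Et Et') e0.
  have near r' : t <= r' -> r' <= t' -> `|r' - r| < d -> ~ flow_set H (phi r' j).
    move=> tr' rt' rd; apply: He; rewrite -ball_normE/=.
    have [rr'|r'r] := leP r r'.
      rewrite distrC; apply: Hd => //.
      by move: rd; rewrite ger0_norm ?subr_ge0.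
    apply: Hd => //; first exact: ltW.
    by move: rd; rewrite ltr0_norm ?subr_lt0// opprB.
  have := flow _ _ _ tt' (slice _ _ _ Et Et').
  move=> /(@ae_dense _ _ (Num.max t (r - d)) (Num.min t' (r + d))) [].
    by rewrite lt_min !gt_max; apply/andP; split; apply/andP; split; lra.
  move=> r' [+ + h]; rewrite gt_max lt_min => /andP[h1 h2] /andP[h3 h4].
  have [|Cr _ _] := h; first by rewrite in_itv/=; apply/andP; split; lra.
  by apply: near Cr; [lra|lra|rewrite ltr_norml; apply/andP; split; lra].
- have lip t t' j : t <= t' -> dom phi (t, j) -> dom phi (t', j) ->
      `|phi t' j - phi t j| <= M * (t' - t).
    move=> tt' Et Et'; apply: norm_le_coord; first by rewrite mulr_ge0// subr_ge0.
    move=> i; pose d : 'rV[R]_n := delta_mx ord0 i.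
    have dE v : dot d v = v ord0 i.
      rewrite /dot (bigD1 i)//= mxE !eqxx mul1r big1 ?addr0// => k ki.
      by rewrite mxE (negbTE ki) andbF mul0r.
    rewrite ler_norml -dE; apply/andP; split.
      rewrite lerNl -dotNr.
      have -> : dot d (- (phi t' j - phi t j)) = dot (- d) (phi t' j - phi t j).
        by rewrite dotNr [RHS]dotC dotNr dotC.
      apply: mean => // r v tr rt Fv.
      rewrite dotC dotNr dotC dE (le_trans (ler_norm _))// normrN.
      apply: (le_trans (coord_le_norm _ _)); apply: HM Fv; apply: vB.
      exact: chained_itv Et Et' tr rt.
    apply: mean => // r v tr rt Fv.
    rewrite dE (le_trans (ler_norm _))//.
    apply: (le_trans (coord_le_norm _ _)); apply: HM Fv; apply: vB.
    exact: chained_itv Et Et' tr rt.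
  move=> t t' j Et Et'; have [tt'|t't] := leP t t'.
    by rewrite [`|t' - t|]ger0_norm ?subr_ge0//; exact: lip.
  by rewrite [in leLHS]distrC ltr0_norm ?subr_lt0// opprB; apply: lip => //; exact: ltW.
Qed.

End solution_to_integral.

Section integral_to_solution.
Context {R : realType} {n : nat} (H : hybrid_inclusion R n).
Context (hH : hybrid_basic_conditions H) (M : R) (psi : pcurve R n).
Context (M0 : 0 <= M) (I : integral_trajectory H M psi).

Lemma integral_ac t t' j : dom psi (t, j) -> dom psi (t', j) ->
  absolutely_continuous_on t t' (fun r => psi r j).
Proof.
move=> Et Et' e e0.
have k0 : 0 < M + 1 by rewrite ltr_wpDl.
exists (e / (M + 1)); first by rewrite divr_gt0.
move=> m l r lr tr; rewrite ltr_pdivlMr// => sd; apply: le_lt_trans sd.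
rewrite mulr_suml; apply: ler_sum => i _; have [tl [lri rt]] := lr i.
have El : dom psi (l i, j) by apply: (chained_itv (it_chained I) Et Et') => //; lra.
have Er : dom psi (r i, j) by apply: (chained_itv (it_chained I) Et Et') => //; lra.
have := it_lipschitz I El Er; rewrite [`|r i - l i|]ger0_norm ?subr_ge0// => h.
by apply: (le_trans h); rewrite [leRHS]mulrDr mulr1 mulrC lerDl subr_ge0.
Qed.

(** If the derivative [v] were outside the convex compact set [flow_map H (psi r j)],
    a direction [w] would separate them strictly. By outer semicontinuity the flow map
    stays on its side of a slightly shifted hyperplane just after [r], and [it_mean]
    bounds the growth of [psi] in the direction [w] by less than its derivative. *)
Lemma integral_derivative t t' j r : dom psi (t, j) -> dom psi (t', j) ->
  t < r -> r < t' -> derivable (fun s => psi s j) r 1 ->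
  flow_map H (psi r j) (derive1 (fun s => psi s j) r).
Proof.
case: hH => [[cC cD] [oF lF] _ FC _] Et Et' tr rt dr.
set v := derive1 _ _; apply: contrapT => nF.
have cE := it_chained I.
have Es s : t <= s -> s <= t' -> dom psi (s, j) by exact: chained_itv Et Et'.
have Er : dom psi (r, j) by apply: Es; exact: ltW.
have Cr : flow_set H (psi r j).
  by apply: (it_flow_set I _ Et Et'); try exact: ltW; exact: lt_trans rt.
have [F0 Fcvx] := FC _ Cr.
have [w [c [wc cv]]] := convex_separation (osc_compact oF lF) F0 Fcvx nF.
pose c' := (c + dot w v) / 2.
have [d d0 Hd] : exists2 d, 0 < d & forall s y, r <= s -> s < r + d -> s <= t' ->
    flow_map H (psi s j) y -> dot w y <= c'.
  apply: contrapT => nd.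
  have /choice[f Hf] : forall k : nat, exists p : R * 'rV[R]_n,
      [/\ r <= p.1, p.1 < r + k.+1%:R^-1, p.1 <= t', flow_map H (psi p.1 j) p.2 &
       c' < dot w p.2].
    move=> k; apply: contrapT => nk; apply: nd; exists (k.+1%:R^-1).
      by rewrite invr_gt0.
    move=> s y rs sd st Fy; rewrite leNgt; apply/negP => cy.
    by apply: nk; exists (s, y).
  have f1 : (fun k => psi (f k).1 j) @ \oo --> psi r j.
    apply/cvgrPdist_le => e e0.
    have k0 : 0 < M + 1 by rewrite ltr_wpDl.
    have ek : 0 < e / (M + 1) by rewrite divr_gt0.
    near=> k; have [rf fr ft _ _] := Hf k.
    have Ef : dom psi ((f k).1, j) by apply: Es => //; lra.
    rewrite (le_trans (it_lipschitz I Ef Er))// ler0_norm ?subr_le0// opprB.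
    have : k.+1%:R^-1 < e / (M + 1).
      by near: k; exact: near_infty_natSinv_lt (PosNum ek).
    rewrite ltr_pdivlMr// => h.
    apply: (@le_trans _ _ ((M + 1) * k.+1%:R^-1)); last by rewrite mulrC ltW.
    by apply: ler_pM => //; [lra|lra|rewrite lerBlDl ltW].
  have Ff k : flow_map H (psi (f k).1 j) (f k).2 by have [] := Hf k.
  have [s [y [hs sy Fy]]] := osc_subseq oF lF f1 Ff.
  have : c' <= dot w y.
    have wy : (fun k => dot w (f (s k)).2) @ \oo --> dot w y by exact: dot_cvg sy.
    apply: (@closed_seq R _ [set x | c' <= x] _ _ _ _ wy); first exact: closed_ge.
    by apply: nearW => k /=; have [_ _ _ _ /ltW] := Hf (s k).
  by have := wc _ Fy; rewrite /c'; move: cv; lra.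
have k0 : 0 < norm1 w + 1 by rewrite ltr_wpDl// norm1_ge0.
(* An error in the expansion of [psi] small enough to keep the growth above [c']. *)
pose e := (dot w v - c') / (norm1 w + 1).
have e0 : 0 < e by rewrite divr_gt0// /c'; lra.
have [d' d'0 Hd'] := derivable_expansion dr e0.
pose h := Num.min (d / 2) (Num.min (d' / 2) (t' - r)).
have h0 : 0 < h by rewrite !lt_min !divr_gt0//= subr_gt0.
have hd : h <= d / 2 by rewrite ge_min lexx.
have hd' : h <= d' / 2 by rewrite !ge_min lexx ?orbT.
have ht : h <= t' - r by rewrite !ge_min lexx ?orbT.
have Erh : dom psi (r + h, j) by apply: Es; lra.
have up : dot w (psi (r + h) j - psi r j) <= c' * h.
  have := @it_mean _ _ _ _ _ I r (r + h) j w c'.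
  rewrite (_ : r + h - r = h); last by ring.
  apply => //; first lra.
  by move=> s y rs sr Fy; apply: (Hd s) => //; lra.
have := Hd' (r + h); rewrite (_ : r + h - r = h); last by ring.
rewrite gtr0_norm// -/v => /(_ ltac:(lra)) lo.
have : `|dot w (psi (r + h) j - psi r j - h *: v)| < (norm1 w + 1) * (e * h).
  apply: le_lt_trans (dot_bound _ _) _.
  apply: (@le_lt_trans _ _ (norm1 w * (e * h))).
    by rewrite ler_wpM2l// norm1_ge0.
  have := mulr_gt0 e0 h0; lra.
rewrite mulrA (mulrC (norm1 w + 1)) /e divfK ?gt_eqF// ltr_norml => /andP[+ _].
rewrite dotBr dotZr; move: up; lra.
Unshelve. all: by end_near. Qed.

Lemma integral_continuous t t' j : dom psi (t, j) -> dom psi (t', j) ->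
  {within `[t, t']%classic, continuous (fun r => psi r j)}.
Proof.
move=> Et Et'; apply/subspace_continuousP => x; rewrite /= in_itv/= => /andP[tx xt].
have Es s : t <= s -> s <= t' -> dom psi (s, j).
  exact: (chained_itv (it_chained I) Et Et').
apply/cvgrPdist_le => e e0; rewrite near_withinE.
have k0 : 0 < M + 1 by rewrite ltr_wpDl.
have ek : 0 < e / (M + 1) by rewrite divr_gt0.
have /cvgrPdist_le/(_ _ ek) : id @ x --> x by exact: cvg_id.
apply: filterS => y /= xy; rewrite in_itv/= => /andP[ty yt].
apply: (le_trans (it_lipschitz I (Es _ ty yt) (Es _ tx xt))).
move: xy; rewrite ler_pdivlMr// mulrC mulrDl mul1r => xy.
by apply: le_trans xy; rewrite lerDl.
Qed.

Lemma integral_ae_flow t t' j : t < t' -> dom psi (t, j) -> dom psi (t', j) ->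
  {ae @lebesgue_measure R, forall r, r \in `[t, t'] ->
     [/\ flow_set H (psi r j), derivable (fun s => psi s j) r 1
       & flow_map H (psi r j) (derive1 (fun s => psi s j) r)]}.
Proof.
move=> tt' Et Et'.
have Es s : t <= s -> s <= t' -> dom psi (s, j).
  exact: (chained_itv (it_chained I) Et Et').
have aeF := ae_filter_ringOfSetsType (@lebesgue_measure R).
have dall : {ae @lebesgue_measure R, forall r, forall i : 'I_n,
    t < r < t' -> derivable (fun s => psi s j ord0 i) r 1}.
  apply: filter_forall => i; apply: (@lipschitz_ae_derivable R _ t t' M).
  move=> x y tx xy yt.
  have -> : psi y j ord0 i - psi x j ord0 i = (psi y j - psi x j) ord0 i by rewrite !mxE.
  apply: (le_trans (coord_le_norm _ _)).
  rewrite -[y - x]ger0_norm ?subr_ge0//.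
  by apply: (it_lipschitz I); apply: Es => //; [exact: le_trans yt|exact: le_trans xy].
have ne (a : R) : {ae @lebesgue_measure R, forall r, r <> a}.
  exists [set a]; split => //; first exact: lebesgue_measure_set1.
  by move=> r /= /contrapT.
have := @filterI _ _ aeF _ _ dall (@filterI _ _ aeF _ _ (ne t) (ne t')).
apply: (@filterS _ _ aeF) => r [dr [/eqP rt /eqP rt']]; rewrite in_itv/= => /andP[tr rt''].
have {}tr : t < r by rewrite lt_neqAle eq_sym rt.
have {}rt' : r < t' by rewrite lt_neqAle rt'.
have dv : derivable (fun s => psi s j) r 1.
  by apply/derivable_mxP => i k; rewrite ord1; apply: dr; rewrite tr.
split => //; first by apply: (it_flow_set I tt' Et Et'); exact: ltW.
by apply: (integral_derivative Et Et').
Qed.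

(** An unbounded domain either flows or jumps at once from the origin. *)
Lemma integral_initial : (flow_set H `|` jump_set H) (psi 0 0%N).
Proof.
have cE := it_chained I.
have flow t : 0 < t -> dom psi (t, 0%N) -> flow_set H (psi 0 0%N).
  by move=> t0 Et; apply: (it_flow_set I t0 (chained00 cE) Et) => //; exact: ltW.
have [t [[|j] [Et lt]]] := it_unbounded I 1.
  by left; apply: flow Et; move: lt; rewrite addr0; lra.
have [s [Es Es1]] : exists s, dom psi (s, 0%N) /\ dom psi (s, 1%N).
  elim: j t Et {lt} => [|j IH] t /(chained_junction cE)[s [_ Es Es1]].
    by exists s.
  exact: IH Es.
have := chained_ge0 cE Es; rewrite le_eqVlt => /orP[/eqP s0|s0].
  by right; rewrite -s0 in Es Es1; have [] := it_jump I Es Es1.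
by left; exact: flow Es.
Qed.

Lemma integral_solution : solutions H psi.
Proof.
have cE := it_chained I.
split; last exact: it_jump I.
- split; last by move=> t t' j _; exact: integral_ac.
  split; first exact: chained_htd (it_unbounded I).
  by move=> t t' j _; exact: integral_continuous.
- exact: integral_initial.
- move=> t t' j tt' sub; apply: integral_ae_flow => //; apply: sub.
    by split => //=; rewrite in_itv/= lexx ltW.
  by split => //=; rewrite in_itv/= lexx ltW.
Qed.

End integral_to_solution.

(** * Graphical limits *)
Section graphs.
Context {R : realType} {n : nat}.
Implicit Types (psi : pcurve R n) (Phi : nat -> pcurve R n).

Lemma graphP psi t j z :
  graph psi ((t, j%:R), z) <-> dom psi (t, j) /\ z = psi t j.
Proof.
split=> [[[t' j'] /= Et [<- /eqP]]|[Et ->]]; last by exists (t, j).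
by rewrite eqr_nat => /eqP <- <-.
Qed.

(** The sets [graph (Phi (s k))] consist of points with a natural second coordinate;
    so do their limit points, and the coordinates of points converging to
    [((t, j), z)] are eventually [j]. *)
Lemma graph_seqP Phi (u : nat -> R * R * 'rV[R]_n) (w : R * R * 'rV[R]_n)
    (s : nat -> nat) :
  (\forall k \near \oo, graph (Phi (s k)) (u k)) -> u @ \oo --> w ->
  exists (t : R) (j : nat) (z : 'rV[R]_n), [/\ w = ((t, j%:R), z), (fun k => (u k).1.1) @ \oo --> t,
    \forall k \near \oo, dom (Phi (s k)) ((u k).1.1, j) /\
       (u k).2 = Phi (s k) (u k).1.1 j & (fun k => (u k).2) @ \oo --> z].
Proof.
move=> nearg uw.
have /choice[b Hb] : forall k, exists b : nat, graph (Phi (s k)) (u k) ->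
    [/\ (u k).1.2 = b%:R, dom (Phi (s k)) ((u k).1.1, b) & (u k).2 = Phi (s k) (u k).1.1 b].
  move=> k; have [[[t j] Et <-]|ng] := pselect (graph (Phi (s k)) (u k)).
    by exists j.
  by exists 0%N.
have u1 := cvg_fst_seq uw.
have u11 := cvg_fst_seq u1; have u12 := cvg_snd_seq u1; have u2 := cvg_snd_seq uw.
have br : (fun k => (b k)%:R : R) @ \oo --> w.1.2.
  apply: cvg_trans u12; apply: near_eq_cvg.
  by apply: filterS nearg => k /Hb[].
have [j wj bj] := cvg_natr br.
exists w.1.1, j, w.2; split => //.
  by rewrite -wj; case: (w) => -[].
by apply: filterS2 nearg bj => k /Hb[_ h1 h2] <-.
Qed.

Lemma bounded_times_subseq (a : nat -> R) (b : nat -> nat) (T : R) :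
  (forall k, 0 <= a k) -> (forall k, a k + (b k)%:R <= T) ->
  exists (s : nat -> nat) (t : R) (j : nat), [/\ {homo s : k l / (k < l)%N}, (a \o s) @ \oo --> t &
    forall k, b (s k) = j].
Proof.
move=> a0 abT.
have b0 k : 0 <= (b k)%:R :> R by [].
have aT k : `|a k| <= T by rewrite ger0_norm//; have := abT k; have := b0 k; lra.
have [s1 [t [hs1 st]]] := bounded_subseq_R aT.
have bT k : `|(b (s1 k))%:R : R| <= T.
  by rewrite ger0_norm//; have := abT (s1 k); have := a0 (s1 k); lra.
have [s2 [r [hs2 sr]]] := bounded_subseq_R bT.
have [j _ [N _ Nj]] := cvg_natr sr.
pose sh k := (k + N)%N.
have hsh : {homo sh : k l / (k < l)%N} by move=> k l; rewrite ltn_add2r.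
exists (s1 \o (s2 \o sh)), t, j; split.
- by move=> k l kl; apply/hs1/hs2/hsh.
- have h : {homo s2 \o sh : k l / (k < l)%N} by move=> k l kl; apply/hs2/hsh.
  exact: (cvg_subseq h st).
- by move=> k; apply: Nj; rewrite /= leq_addl.
Qed.

Lemma graph_limit_in Phi L (B : R) (s : nat -> nat) (b : nat -> R) (t : R) j :
  set_converges (fun k => graph (Phi k)) L ->
  (forall k t j, dom (Phi k) (t, j) -> `|Phi k t j| <= B) ->
  {homo s : k l / (k < l)%N} -> b @ \oo --> t ->
  (\forall k \near \oo, dom (Phi (s k)) (b k, j)) ->
  exists (z : 'rV[R]_n) (s' : nat -> nat), [/\ L ((t, j%:R), z), {homo s' : k l / (k < l)%N} &
    (fun k => Phi (s (s' k)) (b (s' k)) j) @ \oo --> z].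
Proof.
move=> [outL _] HB hs bt [N _ EN].
pose sh k := (k + N)%N.
have hsh : {homo sh : k l / (k < l)%N} by move=> k l; rewrite ltn_add2r.
have Esh k : dom (Phi (s (sh k))) (b (sh k), j) by apply: EN; rewrite /= leq_addl.
have vB k : `|Phi (s (sh k)) (b (sh k)) j| <= B by exact: HB.
have [s1 [z [hs1 sz]]] := bounded_subseq_rV vB.
have h : {homo sh \o s1 : k l / (k < l)%N} by move=> k l kl; apply/hsh/hs1.
exists z, (sh \o s1); split => //.
rewrite -outL; exists (s \o (sh \o s1)),
  (fun k => ((b (sh (s1 k)), j%:R), Phi (s (sh (s1 k))) (b (sh (s1 k))) j)); split.
- by move=> k l kl; apply/hs/h.
- by move=> k; apply/graphP; split => //; exact: Esh.
- apply: cvg_pair_seq sz; apply: cvg_pair_seq; first exact: (cvg_subseq h bt).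
  exact: cvg_cst.
Qed.

Lemma graph_limit_inner Phi L t j z :
  set_converges (fun k => graph (Phi k)) L -> L ((t, j%:R), z) ->
  exists a : nat -> R, [/\ a @ \oo --> t, \forall k \near \oo, dom (Phi k) (a k, j) &
    (fun k => Phi k (a k) j) @ \oo --> z].
Proof.
move=> [_ <-] [u [ug uz]].
have [t' [j' [z' [E ut du u2]]]] := @graph_seqP Phi u _ id ug uz.
case: E => tt' /eqP; rewrite eqr_nat => /eqP jj' zz'.
rewrite tt' jj' zz'; exists (fun k => (u k).1.1); split => //.
  by apply: filterS du => k [].
apply: cvg_trans u2; apply: near_eq_cvg.
by apply: filterS du => k [].
Qed.

End graphs.

Section limit_of_integral_trajectories.
Context {R : realType} {n : nat} (H : hybrid_inclusion R n).
Context (hH : hybrid_basic_conditions H).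
Context (M B : R) (Phi : nat -> pcurve R n) (L : set (R * R * 'rV[R]_n)).
Context (I : forall k, integral_trajectory H M (Phi k))
  (HB : forall k t j, dom (Phi k) (t, j) -> `|Phi k t j| <= B)
  (HL : set_converges (fun k => graph (Phi k)) L).

Let cE k := it_chained (I k).

(** Two values over the same hybrid time are limits of values of the same
    trajectories at times that become arbitrarily close. *)
Lemma limit_single_valued t j z z' : L ((t, j%:R), z) -> L ((t, j%:R), z') -> z = z'.
Proof.
move=> /(graph_limit_inner HL)[a [at_ Ea az]] /(graph_limit_inner HL)[b [bt Eb bz]].
apply: (cvg_unique _ _ bz) => //.
apply: (cvg_lip az at_ bt (M := M)).
by apply: filterS2 Ea Eb => k; exact: it_lipschitz.
Qed.

(** The candidate trajectory whose graph is [L]; by [limit_single_valued] the choice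
    of a value is forced on the domain. *)
Definition limit_curve : pcurve R n :=
  PCurve [set p | exists z, L ((p.1, p.2%:R), z)]
         (fun t j => xget 0 [set z | L ((t, j%:R), z)]).
Local Notation psi := limit_curve.

Lemma limit_curveP t j : dom psi (t, j) -> L ((t, j%:R), psi t j).
Proof. by move=> [z Lz]; rewrite /=; case: xgetP => [y _//|/(_ z)]. Qed.

Lemma limit_in (s : nat -> nat) (b : nat -> R) (t : R) j :
  {homo s : k l / (k < l)%N} -> b @ \oo --> t ->
  (\forall k \near \oo, dom (Phi (s k)) (b k, j)) -> dom psi (t, j).
Proof.
by move=> hs bt Eb; have [z [s' [Lz _ _]]] := graph_limit_in HL HB hs bt Eb; exists z.
Qed.

Lemma limit_inner t j : dom psi (t, j) ->
  exists a : nat -> R, [/\ a @ \oo --> t, \forall k \near \oo, dom (Phi k) (a k, j) &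
    (fun k => Phi k (a k) j) @ \oo --> psi t j].
Proof. by move=> /limit_curveP/(graph_limit_inner HL). Qed.

(** Values along any convergent sequence of times converge, not only along the one
    that the inner limit provides. *)
Lemma limit_cvg (s : nat -> nat) (b : nat -> R) (t : R) j :
  {homo s : k l / (k < l)%N} -> b @ \oo --> t ->
  (\forall k \near \oo, dom (Phi (s k)) (b k, j)) ->
  (fun k => Phi (s k) (b k) j) @ \oo --> psi t j.
Proof.
move=> hs bt Eb; have [a [at_ Ea az]] := limit_inner (limit_in hs bt Eb).
have sE : \forall k \near \oo, dom (Phi (s k)) (a (s k), j) by exact: (subseq_cvg hs Ea).
apply: (cvg_lip (cvg_subseq hs az) (cvg_subseq hs at_) bt (M := M)).
by apply: filterS2 sE Eb => k h1 h2; exact: (it_lipschitz (I (s k)) h1 h2).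
Qed.

Lemma graph_limit_curve : graph psi = L.
Proof.
apply/seteqP; split => [w [[t j] Et <-]|w Lw]; first exact: limit_curveP.
have [t [j [z wE]]] : exists t j z, w = ((t, j%:R), z) :> R * R * 'rV[R]_n.
  move: (Lw); rewrite -HL.2 => -[u [ug uw]].
  by have [t [j [z [-> _ _ _]]]] := @graph_seqP _ _ Phi u w id ug uw; exists t, j, z.
rewrite wE in Lw *; apply/graphP; split; first by exists z.
by apply: (limit_single_valued Lw); apply: limit_curveP; exists z.
Qed.

Lemma homo_id : {homo (id : nat -> nat) : k l / (k < l)%N}. Proof. by []. Qed.

Lemma limit_slice t t' r j : dom psi (t, j) -> dom psi (t', j) ->
  t <= r -> r <= t' ->
  exists b : nat -> R, b @ \oo --> r /\ \forall k \near \oo, dom (Phi k) (b k, j).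
Proof.
move=> /limit_inner[a [at_ Ea _]] /limit_inner[a' [at' Ea' _]] tr rt.
have [tt'|t't] := ltP t t'; last first.
  by exists a; split => //; rewrite (_ : r = t)//; lra.
(* The convex combinations of [a k] and [a' k] that tend to [r]. *)
pose l := (r - t) / (t' - t).
have tt0 : 0 < t' - t by lra.
have l0 : 0 <= l by rewrite divr_ge0//; lra.
have l1 : l <= 1 by rewrite ler_pdivrMr// mul1r; lra.
exists (fun k => a k + l * (a' k - a k)); split.
  have -> : r = t + l * (t' - t) by rewrite divfK ?gt_eqF//; lra.
  by apply: cvgD => //; apply: cvgM; [exact: cvg_cst|exact: cvgB].
have m1 : t < (t + t') / 2 by lra.
have m2 : (t + t') / 2 < t' by lra.
near=> k.
have h1 : a k < (t + t') / 2 by near: k; exact: (cvgr_lt _ at_ _ m1).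
have h2 : (t + t') / 2 < a' k by near: k; exact: (cvgr_gt _ at' _ m2).
have E1 : dom (Phi k) (a k, j) by near: k.
have E2 : dom (Phi k) (a' k, j) by near: k.
have ak : 0 <= a' k - a k by lra.
apply: (chained_itv (cE k) E1 E2); first by rewrite lerDl mulr_ge0.
have : l * (a' k - a k) <= 1 * (a' k - a k) by rewrite ler_wpM2r.
lra.
Unshelve. all: by end_near. Qed.

(** The structure of the domain passes to the limit: inner limits provide the points,
    and compactness turns the new points found in the approximating domains into
    points of the limit. *)
Lemma limit_chained : chained (dom psi).
Proof.
split.
- apply: (limit_in (s := id) (b := fun=> 0)) => //; first exact: cvg_cst.
  by apply: nearW => k; exact: chained00.
- move=> t j /limit_inner[a [at_ Ea _]].
  apply: (@closed_seq R _ [set x : R | 0 <= x] _ _ _ _ at_); first exact: closed_ge.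
  by apply: filterS Ea => k; exact: chained_ge0.
- move=> s t r j Es Et sr rt; have [b [br Eb]] := limit_slice Es Et sr rt.
  exact: (limit_in homo_id br Eb).
- move=> t j /limit_inner[a [at_ Ea _]].
  have [N _ EN] := Ea.
  have [N' _ EN'] : \forall k \near \oo, a k < t + 1.
    by apply: (cvgr_lt _ at_); rewrite ltrDl.
  pose m k := (k + maxn N N')%N.
  have hm : {homo m : k l / (k < l)%N} by move=> k l; rewrite ltn_add2r.
  have Em k : dom (Phi (m k)) (a (m k), j.+1).
    by apply: EN; rewrite /= (leq_trans (leq_maxl _ N'))// leq_addl.
  have am k : a (m k) < t + 1.
    by apply: EN'; rewrite /= (leq_trans (leq_maxr N _))// leq_addl.
  have /choice[c Hc] : forall k, exists c,
      [/\ c <= a (m k), dom (Phi (m k)) (c, j) & dom (Phi (m k)) (c, j.+1)].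
    by move=> k; exact: (chained_junction (cE _) (Em k)).
  have cB k : `|c k| <= t + 1.
    have [c1 c2 _] := Hc k; rewrite ger0_norm; last exact: chained_ge0 c2.
    by have := am k; lra.
  have [s [r [hs sr]]] := bounded_subseq_R cB.
  have hms : {homo m \o s : k l / (k < l)%N} by move=> k l kl; apply/hm/hs.
  exists r; split.
  + apply: (ler_cvg_to sr (cvg_subseq hms at_)).
    by apply: nearW => k /=; have [] := Hc (s k).
  + by apply: (limit_in hms sr); apply: nearW => k; have [] := Hc (s k).
  + by apply: (limit_in hms sr); apply: nearW => k; have [] := Hc (s k).
- move=> s t j /limit_inner[a [at_ Ea _]] /limit_inner[b [bt Eb _]].
  apply: (ler_cvg_to at_ bt).
  by apply: filterS2 Ea Eb => k; exact: chained_step.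
Qed.

Lemma limit_unbounded : unbounded_dom (dom psi).
Proof.
move=> l.
have /choice[p Hp] : forall k, exists p : R * nat,
    [/\ dom (Phi k) p, `|l| <= p.1 + p.2%:R & p.1 + p.2%:R <= `|l| + 1].
  move=> k; have [t [j [Et lt]]] := it_unbounded (I k) `|l|.
  have [r [i [Er lr rl]]] := chained_intermediate (cE k) Et (normr_ge0 l) lt.
  by exists (r, i).
have [||s [t [j [hs st bj]]]] := @bounded_times_subseq R (fun k => (p k).1)
   (fun k => (p k).2) (`|l| + 1).
- by move=> k; have [] := Hp k; case: (p k) => a b /= /(chained_ge0 (cE k)).
- by move=> k; have [] := Hp k.
have Es : \forall k \near \oo, dom (Phi (s k)) ((p (s k)).1, j).
  by apply: nearW => k; rewrite -(bj k) -surjective_pairing; have [] := Hp (s k).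
exists t, j; split; first exact: (limit_in hs st Es).
apply: (le_trans (ler_norm l)); rewrite -lerBlDr.
apply: (@closed_seq R _ [set x | `|l| - j%:R <= x] _ _ _ _ st); first exact: closed_ge.
by apply: nearW => k /=; rewrite lerBlDr -(bj k); have [] := Hp (s k).
Qed.

Lemma limit_lipschitz t t' j : dom psi (t, j) -> dom psi (t', j) ->
  `|psi t' j - psi t j| <= M * `|t' - t|.
Proof.
move=> /limit_inner[a [at_ Ea az]] /limit_inner[b [bt Eb bz]].
apply: (ler_cvg_to (cvg_norm (cvgB bz az)) (cvgM (cvg_cst M) (cvg_norm (cvgB bt at_)))).
by apply: filterS2 Ea Eb => k; exact: it_lipschitz.
Qed.

Lemma limit_flow_set t t' r j : t < t' -> dom psi (t, j) -> dom psi (t', j) ->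
  t <= r -> r <= t' -> flow_set H (psi r j).
Proof.
move=> tt' Et Et' tr rt; have [[cC _] _ _ _ _] := hH.
have [b [br Eb]] := limit_slice Et Et' tr rt.
have bz := limit_cvg homo_id br Eb.
apply: (closed_seq cC _ bz).
have [a [at_ Ea _]] := limit_inner Et; have [a' [at' Ea' _]] := limit_inner Et'.
have m1 : t < (t + t') / 2 by lra.
have m2 : (t + t') / 2 < t' by lra.
near=> k.
have h1 : a k < (t + t') / 2 by near: k; exact: (cvgr_lt _ at_ _ m1).
have h2 : (t + t') / 2 < a' k by near: k; exact: (cvgr_gt _ at' _ m2).
have E1 : dom (Phi k) (a k, j) by near: k.
have E2 : dom (Phi k) (a' k, j) by near: k.
have E3 : dom (Phi k) (b k, j) by near: k.
have [bk|kb] := leP (b k) ((t + t') / 2).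
  by apply: (it_flow_set (I k) _ E3 E2) => //; lra.
by apply: (it_flow_set (I k) _ E1 E3) => //; lra.
Unshelve. all: by end_near. Qed.

(** The times that approximate [t] in the two slices need not be jump times of the
    approximating trajectories, but a jump time lies between them. *)
Lemma limit_jump t j : dom psi (t, j) -> dom psi (t, j.+1) ->
  jump_set H (psi t j) /\ jump_map H (psi t j) (psi t j.+1).
Proof.
have [[_ cD] _ [oG _] _ _] := hH.
move=> Et Et1.
have [a [at_ Ea _]] := limit_inner Et; have [b [bt Eb _]] := limit_inner Et1.
have [N _ EN] := filterI Ea Eb.
pose m k := (k + N)%N.
have hm : {homo m : k l / (k < l)%N} by move=> k l; rewrite ltn_add2r.
have /choice[c Hc] : forall k, exists c, [/\ a (m k) <= c, c <= b (m k),
    dom (Phi (m k)) (c, j) & dom (Phi (m k)) (c, j.+1)].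
  move=> k; have [Eam Ebm] : (dom (Phi (m k)) (a (m k), j) /\ dom (Phi (m k)) (b (m k), j.+1)).
    by apply: EN; rewrite /= leq_addl.
  have [c [cb Ec Ec1]] := chained_junction (cE _) Ebm.
  by exists c; split => //; exact: (chained_step (cE _) Eam Ec1).
have ct : c @ \oo --> t.
  apply: (squeeze_cvgr _ (cvg_subseq hm at_) (cvg_subseq hm bt)).
  by apply: nearW => k /=; have [-> -> _ _] := Hc k.
have Ec : \forall k \near \oo, dom (Phi (m k)) (c k, j).
  by apply: nearW => k; have [] := Hc k.
have Ec1 : \forall k \near \oo, dom (Phi (m k)) (c k, j.+1).
  by apply: nearW => k; have [] := Hc k.
have v0 := limit_cvg hm ct Ec.
have v1 := limit_cvg hm ct Ec1.
have J k : jump_set H (Phi (m k) (c k) j) /\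
    jump_map H (Phi (m k) (c k) j) (Phi (m k) (c k) j.+1).
  by have [_ _ h h1] := Hc k; exact: (it_jump (I (m k)) h h1).
split; first by apply: (closed_seq cD _ v0); apply: nearW => k; have [] := J k.
by apply: (oG _ _ _ _ v0 v1) => k; have [] := J k.
Qed.

(** A bound [c] of the support function along the limit is a bound [c + e] along the
    approximating trajectories from some rank on: otherwise velocities violating it
    would accumulate, by [osc_subseq], at a velocity of the limit. *)
Lemma limit_mean t t' j w c : t <= t' -> dom psi (t, j) -> dom psi (t', j) ->
  (forall r v, t <= r -> r <= t' -> flow_map H (psi r j) v -> dot w v <= c) ->
  dot w (psi t' j - psi t j) <= c * (t' - t).
Proof.
have [_ [oF lF] _ _ _] := hH.
rewrite le_eqVlt => /orP[/eqP <- _ _ _|tt' Et Et' Hc].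
  by rewrite !subrr dot0r mulr0.
have [a [at_ Ea az]] := limit_inner Et; have [a' [at' Ea' az']] := limit_inner Et'.
have unif e : 0 < e -> \forall k \near \oo, forall r v, a k <= r -> r <= a' k ->
    flow_map H (Phi k r j) v -> dot w v <= c + e.
  move=> e0; apply: contrapT => nn.
  have [|s hs sP] := @choose_subseq (fun _ k => exists p : R * 'rV[R]_n,
      [/\ dom (Phi k) (a k, j), dom (Phi k) (a' k, j), a k <= p.1, p.1 <= a' k &
       flow_map H (Phi k p.1 j) p.2 /\ c + e < dot w p.2]).
    move=> _ N; apply: contrapT => nk; apply: nn.
    near=> k; move=> r v ar ra Fv; rewrite leNgt; apply/negP => cv.
    apply: nk; exists k; first by near: k; exists N.
    by exists (r, v); split => //; near: k.
  have /choice[p Hp] := sP.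
  have [r0 [s1 [hs1 sr]]] :
      exists (r0 : R) (s1 : nat -> nat),
        {homo s1 : k l / (k < l)%N} /\ (fun k => (p (s1 k)).1) @ \oo --> r0.
    have [Ba HBa] : exists Ba, forall k, `|(p k).1| <= Ba.
      have [Ba [_ HBa]] := cvg_seq_bounded (cvgP _ at').
      exists (`|Ba| + 1) => k; have [Eak _ ap pa _] := Hp k.
      rewrite ger0_norm; last by apply: le_trans ap; exact: chained_ge0 Eak.
      apply: (le_trans pa); apply: (le_trans (ler_norm _)).
      by apply: HBa => //; have := ler_norm Ba; lra.
    by have [s1 [r0 [? ?]]] := bounded_subseq_R HBa; exists r0, s1.
  have hss : {homo s \o s1 : k l / (k < l)%N} by move=> k l kl; apply/hs/hs1.
  have Ep : \forall k \near \oo, dom (Phi ((s \o s1) k)) ((p (s1 k)).1, j).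
    apply: nearW => k; have [E1 E2 h1 h2 _] := Hp (s1 k).
    exact: (chained_itv (cE _) E1 E2).
  have pz := limit_cvg hss sr Ep.
  have Fp k : flow_map H (Phi ((s \o s1) k) (p (s1 k)).1 j) (p (s1 k)).2.
    by have [_ _ _ _ []] := Hp (s1 k).
  have [s2 [v [hs2 sv Fv]]] := osc_subseq oF lF pz Fp.
  have tr : t <= r0.
    apply: (ler_cvg_to (cvg_subseq hss at_) sr).
    by apply: nearW => k /=; have [] := Hp (s1 k).
  have rt : r0 <= t'.
    apply: (ler_cvg_to sr (cvg_subseq hss at')).
    by apply: nearW => k /=; have [] := Hp (s1 k).
  have wv : (fun k => dot w (p (s1 (s2 k))).2) @ \oo --> dot w v by exact: dot_cvg sv.
  have : c + e <= dot w v.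
    apply: (@closed_seq R _ [set x | c + e <= x] _ _ _ _ wv); first exact: closed_ge.
    by apply: nearW => k /=; have [_ _ _ _ [_ /ltW]] := Hp (s1 (s2 k)).
  by have := Hc _ _ tr rt Fv; lra.
have key e : 0 < e -> dot w (psi t' j - psi t j) <= (c + e) * (t' - t).
  move=> e0; have un := unif e e0.
  have l1 : (fun k => dot w (Phi k (a' k) j - Phi k (a k) j)) @ \oo -->
      dot w (psi t' j - psi t j) by apply: dot_cvg; exact: cvgB.
  have l2 : (fun k => (c + e) * (a' k - a k)) @ \oo --> (c + e) * (t' - t).
    by apply: cvgM; [exact: cvg_cst|exact: cvgB].
  apply: (ler_cvg_to l1 l2).
  have m1 : t < (t + t') / 2 by lra.
  have m2 : (t + t') / 2 < t' by lra.
  near=> k.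
  have h1 : a k < (t + t') / 2 by near: k; exact: (cvgr_lt _ at_ _ m1).
  have h2 : (t + t') / 2 < a' k by near: k; exact: (cvgr_gt _ at' _ m2).
  apply: (it_mean (I k)); first lra.
  - by near: k.
  - by near: k.
  - by near: k.
apply/ler_addgt0Pr => e e0.
have := key (e / (t' - t)); rewrite mulrDl divfK; last by rewrite subr_eq0 gt_eqF.
by apply; rewrite divr_gt0// subr_gt0.
Unshelve. all: by end_near. Qed.

Theorem limit_integral : integral_trajectory H M psi.
Proof.
split.
- exact: limit_chained.
- exact: limit_unbounded.
- exact: limit_flow_set.
- exact: limit_mean.
- exact: limit_lipschitz.
- exact: limit_jump.
Qed.

End limit_of_integral_trajectories.

(** Tails of a bounded complete solution are integral trajectories with common
    bounds, and so are their graphical limits. *)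
Theorem solution_asymptotic (R : realType) (n : nat) (H : hybrid_inclusion R n)
    (phi : pcurve R n) : hybrid_basic_conditions H ->
  solutions H phi -> bounded_curve phi -> complete_curve phi ->
  asymptotic_solution H phi.
Proof.
move=> hH sphi bphi cphi.
have [M M0 I] := solution_integral hH sphi bphi cphi.
have [B _ HB] := bounded_setP bphi.
split => //; first by have [[]] := sphi.
move=> t j L Et _ HL.
pose Phi k := tail phi (t k) (j k).
have IP k : integral_trajectory H M (Phi k) by exact: integral_tail.
have BP k s i : dom (Phi k) (s, i) -> `|Phi k s i| <= B.
  by move=> [_ /= E]; apply: HB; exists (t k + s, (j k + i)%N).
have IL := limit_integral hH IP BP HL.
exists (limit_curve L); split.
- exact: (integral_solution hH M0 IL).
- by apply/complete_unbounded; [exact: it_chained IL|exact: it_unbounded IL].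
- exact: (graph_limit_curve IP HL).
Qed.

(** * Internal chain transitivity of the omega-limit set *)
Section chain_transitivity.
Context {R : realType} {n : nat} (H : hybrid_inclusion R n) (phi : pcurve R n).
Context (aphi : asymptotic_solution H phi).

Let cE : chained (dom phi).
Proof. by have [[/htd_chained]] := aphi. Qed.

(** Compactness of set convergence and the definition of asymptotic solutions: later
    and later tails accumulate at complete solutions. *)
Lemma tails_subseq (p : nat -> R * nat) :
  (forall k, dom phi (p k)) -> (forall k, k%:R <= (p k).1 + (p k).2%:R) ->
  exists (s : nat -> nat) (psi : pcurve R n),
    [/\ {homo s : k l / (k < l)%N}, solutions H psi, unbounded_dom (dom psi) &
     set_converges (fun k => graph (tail phi (p (s k)).1 (p (s k)).2)) (graph psi)].
Proof.
move=> Ep pk; have [_ _ _ lim] := aphi.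
have [d dd] := rat_dense R n.
have [s [L [hs HL]]] := set_converges_subseq
  (fun k => graph (tail phi (p k).1 (p k).2)) dd.
have [|||psi [spsi cpsi gpsi]] := lim (fun k => (p (s k)).1) (fun k => (p (s k)).2) L.
- by move=> k; rewrite -surjective_pairing.
- apply/cvgryPge => A; near=> k.
  apply: le_trans (pk (s k)).
  have : A <= k%:R by near: k; exact: nbhs_infty_ger.
  by move=> /le_trans; apply; rewrite ler_nat subseq_ge.
- exact: HL.
exists s, psi; split => //; last by rewrite gpsi.
apply/complete_unbounded => //.
by have [[[/htd_chained]]] := spsi.
Unshelve. all: by end_near. Qed.

(** The limits of tails live in the omega-limit set: their points are limits of
    points of [phi] at times going to infinity. *)
Lemma limit_in_omega (p : nat -> R * nat) (s : nat -> nat) psi :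
  (forall k, dom phi (p k)) -> (forall k, k%:R <= (p k).1 + (p k).2%:R) ->
  {homo s : k l / (k < l)%N} ->
  set_converges (fun k => graph (tail phi (p (s k)).1 (p (s k)).2)) (graph psi) ->
  forall a i, dom psi (a, i) -> omega_limit phi (psi a i).
Proof.
move=> Ep pk hs HL a i Ea.
have [|b [ba [N _ EN] bz]] := graph_limit_inner (t := a) (j := i) (z := psi a i) HL.
  exact/graphP.
pose m k := (k + N)%N.
have hm : {homo m : k l / (k < l)%N} by move=> k l; rewrite ltn_add2r.
have Eb k : 0 <= b (m k) /\ dom phi ((p (s (m k))).1 + b (m k), ((p (s (m k))).2 + i)%N).
  by apply: (EN (m k)); rewrite /= leq_addl.
exists (fun k => (p (s (m k))).1 + b (m k)), (fun k => ((p (s (m k))).2 + i)%N); split.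
- by move=> k; have [] := Eb k.
- apply/cvgryPge => A; near=> k.
  have h1 : A <= k%:R by near: k; exact: nbhs_infty_ger.
  have h2 : (k%:R : R) <= (s (m k))%:R.
    by rewrite ler_nat; apply: leq_trans (subseq_ge hs _); exact: subseq_ge hm k.
  have h3 := pk (s (m k)); have [h4 _] := Eb k.
  have h5 : (0 : R) <= i%:R by [].
  by rewrite natrD; lra.
- exact: (cvg_subseq hm bz).
Unshelve. all: by end_near. Qed.

(** One step of the chain from [x] to [y], with the error measured in the maximum
    norm and the whole range of the solution inside the omega-limit set. *)
Definition link (tau e : R) (x y : 'rV[R]_n) : Prop :=
  exists (psi : pcurve R n) t j,
    [/\ solutions H psi, dom psi (t, j) /\ tau <= t + j%:R, psi 0 0%N = x,
      `|y - psi t j| <= e & forall s i, dom psi (s, i) -> omega_limit phi (psi s i)].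

(** Any two late points of [phi] at bounded hybrid distance are joined, up to [e], by
    a solution inside the omega-limit set. A sequence of counterexamples would have
    convergent tails, and the limit solution would join the limits of the two
    points. *)
Lemma shadowing (tau T e : R) : 0 < e -> exists l, forall p q,
  dom phi p -> dom phi q -> l <= p.1 + p.2%:R ->
  0 <= tau -> tau <= (q.1 + q.2%:R) - (p.1 + p.2%:R) ->
  (q.1 + q.2%:R) - (p.1 + p.2%:R) <= T ->
  exists2 x, `|x - phi p.1 p.2| <= e & link tau e x (phi q.1 q.2).
Proof.
move=> e0; apply: contrapT => nS.
pose bad (pq : (R * nat) * (R * nat)) := let: (p, q) := pq in
  [/\ dom phi p, dom phi q, 0 <= tau, tau <= (q.1 + q.2%:R) - (p.1 + p.2%:R) &
    (q.1 + q.2%:R) - (p.1 + p.2%:R) <= T /\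
    ~ exists2 x, `|x - phi p.1 p.2| <= e & link tau e x (phi q.1 q.2)].
have /choice[pq Hpq] : forall k : nat, exists pq : (R * nat) * (R * nat),
    bad pq /\ k%:R <= pq.1.1 + pq.1.2%:R.
  move=> k; apply: contrapT => nk; apply: nS; exists k%:R => p q Ep Eq kp t0 h1 h2.
  by apply: contrapT => nx; apply: nk; exists (p, q).
pose p k := (pq k).1; pose q k := (pq k).2.
have B k : bad (p k, q k) by rewrite -surjective_pairing; have [] := Hpq k.
have Ep k : dom phi (p k) by have [] := B k.
have Eq k : dom phi (q k) by have [] := B k.
have pk k : k%:R <= (p k).1 + (p k).2%:R by have [] := Hpq k.
have [s [psi [hs spsi upsi HL]]] := tails_subseq Ep pk.
have [_ bphi _ _] := aphi; have [C _ HC] := bounded_setP bphi.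
pose Phi k := tail phi (p (s k)).1 (p (s k)).2.
have BP k a i : dom (Phi k) (a, i) -> `|Phi k a i| <= C.
  by move=> [_ /= E]; apply: HC; exists ((p (s k)).1 + a, ((p (s k)).2 + i)%N).
pose a k := (q (s k)).1 - (p (s k)).1.
pose b k := ((q (s k)).2 - (p (s k)).2)%N.
have ord k : (p (s k)).1 <= (q (s k)).1 /\ ((p (s k)).2 <= (q (s k)).2)%N.
  have [] := B (s k) => h1 h2 h3 h4 _.
  apply: (chained_order cE); rewrite -?surjective_pairing//; lra.
have a0 k : 0 <= a k by have [] := ord k; rewrite subr_ge0.
have abE k : a k + (b k)%:R =
    ((q (s k)).1 + (q (s k)).2%:R) - ((p (s k)).1 + (p (s k)).2%:R).
  by have [_ h] := ord k; rewrite /a /b natrB//; lra.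
have abT k : a k + (b k)%:R <= T by rewrite abE; have [_ _ _ _ []] := B (s k).
have [s1 [t [j [hs1 at_ bj]]]] := bounded_times_subseq a0 abT.
have pa k : (p (s k)).1 + a k = (q (s k)).1 by rewrite /a; lra.
have pb k : ((p (s k)).2 + b k)%N = (q (s k)).2 by have [_ h] := ord k; rewrite subnKC.
have Ea : \forall k \near \oo, dom (Phi (s1 k)) (a (s1 k), j).
  apply: nearW => k; split => /=; first exact: a0.
  by rewrite -(bj k) pa pb -surjective_pairing.
have [z [s2 [Lz hs2 qz]]] := graph_limit_in HL BP hs1 at_ Ea.
have hs12 : {homo s1 \o s2 : k l / (k < l)%N} by move=> k l kl; apply/hs1/hs2.
have E0 : \forall k \near \oo, dom (Phi ((s1 \o s2) k)) (0, 0%N).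
  by apply: nearW => k; split => //=; rewrite addr0 addn0 -surjective_pairing.
have [z0 [s3 [Lz0 hs3 pz]]] := graph_limit_in HL BP hs12 (cvg_cst (0 : R)) E0.
move/graphP : Lz => [Et zE]; move/graphP : Lz0 => [_ z0E].
pose m := s1 \o s2 \o s3.
have hm : {homo m : k l / (k < l)%N} by move=> k l kl; apply/hs1/hs2/hs3.
have qm : (fun k => phi (q (s (m k))).1 (q (s (m k))).2) @ \oo --> psi t j.
  rewrite -zE; have := cvg_subseq hs3 qz; apply: cvg_trans; apply: near_eq_cvg.
  by apply: nearW => k /=; rewrite -(bj (s2 (s3 k))) pa pb.
have pm : (fun k => phi (p (s (m k))).1 (p (s (m k))).2) @ \oo --> psi 0 0%N.
  rewrite -z0E; move: pz; apply: cvg_trans; apply: near_eq_cvg.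
  by apply: nearW => k /=; rewrite addr0 addn0.
near \oo => k.
have [_ _ _ _ [_]] := B (s (m k)); apply.
exists (psi 0 0%N); first by near: k; move/cvgrPdist_le : pm; apply.
exists psi, t, j; split => //.
- split => //.
  rewrite -lerBlDr; apply: (@closed_seq R _ [set x : R | tau - j%:R <= x] _ _ _ _ at_).
    exact: closed_ge.
  apply: nearW => l /=; rewrite lerBlDr -(bj l) abE.
  by have [] := B (s (s1 l)).
- rewrite distrC; near: k; move/cvgrPdist_le : qm; exact.
- exact: limit_in_omega Ep pk hs HL.
Unshelve. all: by end_near. Qed.

Inductive chain (tau e : R) : 'rV[R]_n -> 'rV[R]_n -> Prop :=
| chain_last x y : link tau e x y -> chain tau e x y
| chain_cons x y z : link tau e x y -> chain tau e y z -> chain tau e x z.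

Lemma link_weaken tau e d x y z : link tau e x y -> `|z - y| <= d ->
  link tau (e + d) x z.
Proof.
move=> [psi [t [j [spsi Et x0 yE om]]]] zy; exists psi, t, j; split => //.
rewrite (_ : z - psi t j = (y - psi t j) + (z - y)); last by rewrite [RHS]addrC subrKA.
by rewrite (le_trans (ler_normD _ _))// lerD.
Qed.

(** A stretch of [phi] is cut into pieces of hybrid length between [tau] and
    [2 * tau + 1], each of which is shadowed. *)
Lemma chain_along (tau e : R) : 0 < tau -> 0 < e -> exists l, forall p q y,
  dom phi p -> dom phi q -> l <= p.1 + p.2%:R ->
  tau <= (q.1 + q.2%:R) - (p.1 + p.2%:R) -> `|y - phi q.1 q.2| <= e ->
  exists2 x, `|x - phi p.1 p.2| <= e & chain tau (e + e) x y.
Proof.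
move=> tau0 e0; have [l Hl] := shadowing tau (2 * tau + 1) e0.
exists l => p q y Ep Eq lp.
suff main : forall N : nat, forall p, dom phi p -> l <= p.1 + p.2%:R ->
    tau <= (q.1 + q.2%:R) - (p.1 + p.2%:R) ->
    (q.1 + q.2%:R) - (p.1 + p.2%:R) <= tau * N.+1%:R -> `|y - phi q.1 q.2| <= e ->
    exists2 x, `|x - phi p.1 p.2| <= e & chain tau (e + e) x y.
  move=> h1 h2.
  apply: (main (Num.bound (((q.1 + q.2%:R) - (p.1 + p.2%:R)) / tau))) => //.
  rewrite -ler_pdivrMl// mulrC ltW// (lt_trans (archi_boundP _))//.
    by rewrite divr_ge0//; lra.
  by rewrite ltr_nat.
move=> N; elim: N => [|N IH] {}p {}Ep {}lp h1 h2 yq.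
  have [|x px lx] := Hl p q Ep Eq lp (ltW tau0) h1; first by move: h2; rewrite mulr1; lra.
  by exists x => //; apply: chain_last; exact: link_weaken lx yq.
have [h3|h3] := leP ((q.1 + q.2%:R) - (p.1 + p.2%:R)) (2 * tau + 1).
  have [x px lx] := Hl p q Ep Eq lp (ltW tau0) h1 h3.
  by exists x => //; apply: chain_last; exact: link_weaken lx yq.
have p0 : 0 <= p.1 + p.2%:R.
  by rewrite addr_ge0//; apply: (@chained_ge0 _ _ cE p.1 p.2); rewrite -surjective_pairing.
have [|||r [i [Er r1 r2]]] := @chained_intermediate R _ q.1 q.2 (p.1 + p.2%:R + tau) cE.
- by rewrite -surjective_pairing.
- by lra.
- by lra.
have [x' rx' cx'] : exists2 x, `|x - phi r i| <= e & chain tau (e + e) x y.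
  by apply: (IH (r, i)) => //=; lra.
have [||x px lx] := Hl p (r, i) Ep Er lp (ltW tau0).
- by rewrite /=; lra.
- by rewrite /=; lra.
by exists x => //; apply: chain_cons cx'; exact: link_weaken lx rx'.
Qed.

Lemma omega_visit (y : 'rV[R]_n) (l e : R) : omega_limit phi y -> 0 < e ->
  exists p, [/\ dom phi p, l <= p.1 + p.2%:R & `|y - phi p.1 p.2| <= e].
Proof.
move=> [t [j [Etj tj yl]]] e0; near \oo => k.
exists (t k, j k); split => //=.
  by near: k; move/cvgryPge : tj; apply.
by near: k; move/cvgrPdist_le : yl; apply.
Unshelve. all: by end_near. Qed.

(** Unlike a shadow, the first solution of the chain must start exactly at [x]: it is
    a limit of tails of [phi] whose initial points tend to [x]. *)
Lemma omega_start (x : 'rV[R]_n) (tau l e : R) : omega_limit phi x -> 0 < e ->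
  exists p, [/\ dom phi p, l <= p.1 + p.2%:R & link tau e x (phi p.1 p.2)].
Proof.
move=> xo e0.
have /choice[p Hp] : forall k : nat, exists p, [/\ dom phi p,
    k%:R <= p.1 + p.2%:R & `|x - phi p.1 p.2| <= k.+1%:R^-1].
  by move=> k; apply: omega_visit => //; rewrite invr_gt0.
have Ep k : dom phi (p k) by have [] := Hp k.
have pk k : k%:R <= (p k).1 + (p k).2%:R by have [] := Hp k.
have px : (fun k => phi (p k).1 (p k).2) @ \oo --> x.
  apply/cvgrPdist_le => d d0; near=> k.
  have [_ _] := Hp k; move=> /le_trans; apply; apply/ltW.
  by near: k; exact: near_infty_natSinv_lt (PosNum d0).
have [s [psi [hs spsi upsi HL]]] := tails_subseq Ep pk.
have [_ bphi _ _] := aphi; have [C _ HC] := bounded_setP bphi.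
pose Phi k := tail phi (p (s k)).1 (p (s k)).2.
have BP k a i : dom (Phi k) (a, i) -> `|Phi k a i| <= C.
  by move=> [_ /= E]; apply: HC; exists ((p (s k)).1 + a, ((p (s k)).2 + i)%N).
have E0 : \forall k \near \oo, dom (Phi k) (0, 0%N).
  by apply: nearW => k; split => //=; rewrite addr0 addn0 -surjective_pairing.
have [z0 [s3 [Lz0 hs3 pz]]] :=
  graph_limit_in (s := id) HL BP (fun k l kl => kl) (cvg_cst (0 : R)) E0.
have psi0 : psi 0 0%N = x.
  move/graphP : Lz0 => [_ <-].
  apply: (cvg_unique _ pz) => //.
  have hss : {homo s \o s3 : k l / (k < l)%N} by move=> k l' kl; apply/hs/hs3.
  have := cvg_subseq hss px; apply: cvg_trans; apply: near_eq_cvg.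
  by apply: nearW => k /=; rewrite addr0 addn0.
have [a [i [Ea ta]]] := upsi tau.
have [|b [ba Eb bz]] := graph_limit_inner (t := a) (j := i) (z := psi a i) HL.
  exact/graphP.
near \oo => k.
have [b0 Ebk] : dom (Phi k) (b k, i) by near: k; exact: Eb.
exists ((p (s k)).1 + b k, ((p (s k)).2 + i)%N); split => //=.
  have h1 : l <= k%:R by near: k; exact: nbhs_infty_ger.
  have h2 : (k%:R : R) <= (s k)%:R by rewrite ler_nat subseq_ge.
  have h3 := pk (s k); have h5 : (0 : R) <= i%:R by [].
  by rewrite natrD; move: b0 => /= b0; lra.
exists psi, a, i; split => //; last exact: limit_in_omega Ep pk hs HL.
by rewrite distrC; near: k; move/cvgrPdist_le : bz; apply.
Unshelve. all: by end_near. Qed.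

Lemma chain_unroll tau e x y : chain tau e x y ->
  exists (m : nat) (xs : nat -> 'rV[R]_n), [/\ (1 <= m)%N, xs 0%N = x, xs m = y &
    forall k, (k < m)%N -> link tau e (xs k) (xs k.+1)].
Proof.
elim=> {x y} [x y lxy|x y z lxy _ [m [xs [m1 xs0 xsm Hxs]]]].
  by exists 1%N, (fun k => if k is 0 then x else y); split => // -[].
exists m.+1, (fun k => if k is k'.+1 then xs k' else x); split => //.
by case=> [_|k km]; [rewrite xs0|exact: Hxs].
Qed.

Lemma unit_ball_scale (e : R) (v : 'rV[R]_n) : 0 < e -> `|v| <= e / n.+1%:R ->
  unit_ball (e^-1 *: v).
Proof.
move=> e0 ve; rewrite /unit_ball/= -[leRHS]sqrtr1 ler_sqrt//.
have n0 : 0 < n.+1%:R :> R by [].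
apply: (@le_trans _ _ (\sum_(i < n) n.+1%:R^-1)); last first.
  rewrite sumr_const card_ord -[leLHS]mulr_natl ler_pdivrMr// mul1r ler_nat; exact: leqnSn.
apply: ler_sum => i _; rewrite mxE.
have h : `|e^-1 * v ord0 i| <= n.+1%:R^-1.
  rewrite normrM gtr0_norm ?invr_gt0// ler_pdivrMl//.
  exact: le_trans (coord_le_norm _ _) ve.
have h1 : n.+1%:R^-1 <= 1 :> R by rewrite invf_le1// ler1n.
rewrite -real_normK ?num_real// expr2.
by apply: (@le_trans _ _ (n.+1%:R^-1 * 1)); [apply: ler_pM => //; exact: le_trans h1|rewrite mulr1].
Qed.

(** A first link leads from [x] to a late point of [phi]; from there the chain follows
    [phi] until it comes close to [y]. Dividing the error by [n + 1] passes from the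
    maximum norm to the Euclidean ball. *)
Theorem omega_chain_transitive :
  internally_chain_transitive (solutions H) (omega_limit phi).
Proof.
move=> x y tau e ox oy tau0 e0.
pose d := e / n.+1%:R / 2.
have d0 : 0 < d by rewrite !divr_gt0.
have [l Hl] := chain_along tau0 d0.
have [p [Ep lp xp]] := omega_start tau l ox d0.
have [q [Eq lq yq]] := omega_visit (p.1 + p.2%:R + tau) oy d0.
have [|x' px' cx'] := Hl p q y Ep Eq lp _ yq; first lra.
have cxy : chain tau (d + d) x y by apply: chain_cons cx'; exact: link_weaken xp px'.
have [m [xs [m1 xs0 xsm Hxs]]] := chain_unroll cxy.
have /choice[f Hf] : forall k, exists f : pcurve R n * R * nat, (k < m)%N ->
  [/\ solutions H f.1.1, dom f.1.1 (f.1.2, f.2) /\ tau <= f.1.2 + f.2%:R,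
    f.1.1 0 0%N = xs k, `|xs k.+1 - f.1.1 f.1.2 f.2| <= d + d &
    forall s i, dom f.1.1 (s, i) -> omega_limit phi (f.1.1 s i)].
  move=> k; have [km|_] := ltnP k m; last by exists (phi, 0, 0%N).
  by have [psi [t [j h]]] := Hxs k km; exists (psi, t, j).
exists m, xs, (fun k => (f k).1.1), (fun k => (f k).1.2), (fun k => (f k).2); split => //.
move=> k km; have [h1 h2 h3 h4 h5] := Hf k km; split => //; last by move=> s i + _; exact: h5.
exists (e^-1 *: (xs k.+1 - (f k).1.1 (f k).1.2 (f k).2)).
  apply: unit_ball_scale => //; apply: (le_trans h4).
  by rewrite /d -splitr.
by rewrite scalerA divff ?gt_eqF// scale1r addrC subrK.
Qed.

End chain_transitivity.

Theorem corollary4p4 (R : realType) (n : nat) (H : hybrid_inclusion R n)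
    (hH : hybrid_basic_conditions H) :
  (forall phi : pcurve R n, asymptotic_solution H phi ->
     internally_chain_transitive (solutions H) (omega_limit phi)) /\
  (forall phi : pcurve R n, solutions H phi -> bounded_curve phi ->
     complete_curve phi ->
     internally_chain_transitive (solutions H) (omega_limit phi)).
Proof.
split=> [phi|phi sphi bphi cphi]; first exact: omega_chain_transitive.
by apply: omega_chain_transitive; exact: solution_asymptotic.
Qed.
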